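(* Let $H$ be a reproducing kernel Hilbert space with bounded measurable kernel $k$ on a measurable space $(X,\mathcal A)$ and let $\mu$ be a finite measure on the $\sigma$-algebra $\mathcal A$. Assume that $$e_n\bigl(I_{k,\mu}:H\to L_2(\mu)\bigr)\asymp e_n\bigl(I_{k,\mu}:H\to L_\infty(\mu)\bigr)\asymp n^{-1/\alpha}$$ for some $\alpha\in(0,2)$. Then $$d_n\bigl(H,L_\infty(\mu)\bigr)\asymp n^{-1/\alpha}\qquad\text{and}\qquad n^{-1/\alpha+1/2}\prec I_n\bigl(H,L_\infty(\mu)\bigr).$$
   Context: For a Banach space $E$, $B_E$ denotes its closed unit ball and $E'$ its dual. For sequences $(a_n)_{n\ge1},(b_n)_{n\ge1}$ of nonnegative reals, $a_n\prec b_n$ means that there is a constant $c\in(0,\infty)$ with $a_n\le c\,b_n$ for all $n\ge1$; $a_n\asymp b_n$ means $a_n\prec b_n$ and $b_n\prec a_n$. $H$ is a Hilbert space of real-valued functions on $X$, and $I_{k,\mu}:H\to L_p(\mu)$ is the map $I_{k,\mu}f:=[f]_\sim$, where $[f]_\sim$ is the $\mu$-equivalence class of $f$. Entropy numbers: for a bounded linear operator $T:E\to F$ between Banach spaces and $n\ge1$, $e_n(T):=\inf\{\varepsilon>0:\exists\,x_1,\dots,x_{2^{n-1}}\in F \text{ with } TB_E\subset\bigcup_{i=1}^{2^{n-1}}(x_i+\varepsilon B_F)\}$. Kolmogorov $n$-width: $d_n(H,L_p(\mu)):=\inf_{F_n}\sup_{f\in B_H}\inf_{g\in F_n}\|[f]_\sim-g\|_{L_p(\mu)}$,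 where the infimum runs over all subspaces $F_n\subset L_p(\mu)$ with $\dim F_n\le n$. Linear interpolation $n$-width: for a finite set of points $D=\{x_1,\dots,x_m\}\subset X$, let $A_D:H\to H$ be the bounded linear operator $A_Df(x):=\sum_{i=1}^m\alpha_i^*(x)f(x_i)$, where $\alpha^*(x)\in\mathbb R^m$ minimizes $\alpha\mapsto\|\delta_x-\sum_{i=1}^m\alpha_i\delta_{x_i}\|_{H'}^2$ over $\mathbb R^m$, and $\delta_y\in H'$ denotes evaluation at $y$, $\delta_y f=f(y)$ (the functional $\sum_i\alpha_i^*(x)\delta_{x_i}$ does not depend on the choice of minimizer). Then $$I_n\bigl(H,L_\infty(\mu)\bigr):=\inf_{D\subset X,\ |D|\le n}\ \operatorname*{ess\,sup}_{x\in X}\ \sup_{f\in B_H}|f(x)-A_Df(x)|,$$ with the essential supremum taken with respect to $\mu$. *)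

(* Defs.v *)
From HB Require Import structures.
From mathcomp Require Import all_boot all_order all_algebra.
From mathcomp Require Import all_classical all_reals all_analysis.
From mathcomp Require Import ess_sup_inf.

Set Implicit Arguments.
Unset Strict Implicit.
Unset Printing Implicit Defensive.
Import Order.TTheory GRing.Theory Num.Theory.
Import numFieldNormedType.Exports.
Local Open Scope classical_set_scope.
Local Open Scope ring_scope.

(* Comparison of sequences indexed by n >= 1.  All the quantities below are
   nonnegative infima, taken in \bar R so that no boundedness proof is needed. *)
Section Comparison.
Context {R : realType}.
Local Open Scope ereal_scope.

Definition seq_prec (a b : nat -> \bar R) : Prop :=
  exists2 c : R, (0 < c)%R & forall n, (0 < n)%N -> a n <= c%:E * b n.

Definition seq_asymp (a b : nat -> \bar R) : Prop :=
  seq_prec a b /\ seq_prec b a.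

End Comparison.

Section RKHS.
Context {d : measure_display} {X : measurableType d} {R : realType}
        {H : completeNormedModType R}.

(* H is a Hilbert space of real-valued functions on X: its norm comes from an
   inner product, and the injective linear map ev sends an abstract element of
   H to the function X -> R that it is. *)
Definition is_hilbert_function_space (ip : {dot H for idfun})
    (ev : H -> X -> R) : Prop :=
  [/\ forall f : H, ip f f = `|f| ^+ 2,
      forall (a : R) (f g : H) (x : X),
        ev (a *: f + g) x = a * ev f x + ev g x
    & injective ev].

Definition is_reproducing_kernel (ip : {dot H for idfun}) (ev : H -> X -> R)
    (k : X * X -> R) : Prop :=
  forall x, exists2 kx : H,
    (forall y, ev kx y = k (x, y)) & (forall f, ip f kx = ev f x).

Definition bounded_kernel (k : X * X -> R) : Prop :=
  exists M : R, forall z, `|k z| <= M.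

Definition unit_ball : set H := [set f | `|f| <= 1].

Definition dual_norm (phi : H -> R) : \bar R :=
  ereal_sup [set (`|phi f|)%:E | f in unit_ball].

End RKHS.

(* The elements of L_p(mu) are represented by the p-integrable functions of
   LfunType mu p1, on which the library puts the vector space structure; since
   'N[mu]_p[_] is invariant under mu-a.e. equality, the widths and entropy
   numbers are those of the quotient by a.e. equality. *)
Section Widths.
Context {d : measure_display} {X : measurableType d} {R : realType}
        {H : completeNormedModType R}.
Variables (mu : {measure set X -> \bar R}) (ev : H -> X -> R).

Section Lp.
Variables (p : \bar R) (p1 : (1 <= p)%E).

Definition Lp_dist (f : H) (g : LfunType mu p1) : \bar R :=
  'N[mu]_p[EFin \o (fun x => ev f x - g x)%R]%E.

(* e_n of the map f |-> [f] from H to L_p(mu) *)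
Definition entropy_number (n : nat) : \bar R :=
  ereal_inf [set eps%:E | eps in [set eps : R | 0 < eps /\
    exists c : 'I_(2 ^ n.-1) -> LfunType mu p1,
      forall f : H, unit_ball f -> exists i, (Lp_dist f (c i) <= eps%:E)%E]].

(* A subspace has dimension at most n iff it is spanned by n vectors, not
   necessarily distinct or independent. *)
Definition subspace_dim_le (V : lmodType R) (n : nat) (F : set V) : Prop :=
  exists g : 'I_n -> V,
    F = [set v | exists c : 'I_n -> R, v = \sum_(i < n) c i *: g i].

Definition kolmogorov_width (n : nat) : \bar R :=
  ereal_inf [set ereal_sup [set ereal_inf [set Lp_dist f g | g in F]
                           | f in unit_ball]
            | F in [set F : set (LfunType mu p1) | subspace_dim_le n F]].

End Lp.

Section Interpolation.
Variables (m : nat) (D : 'I_m -> X).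

Definition delta_residual (x : X) (a : 'rV[R]_m) (f : H) : R :=
  ev f x - \sum_(i < m) a 0 i * ev f (D i).

Definition optimal_coeff (x : X) (a : 'rV[R]_m) : Prop :=
  forall b : 'rV[R]_m,
    ((dual_norm (delta_residual x a)) ^+ 2 <=
     (dual_norm (delta_residual x b)) ^+ 2)%E.

(* A choice of minimizer; a minimizer exists since the span of the evaluations
   at the points of D is finite-dimensional, so the default 0 is never used
   when ev is the embedding of a reproducing kernel Hilbert space. *)
Definition alpha_star (x : X) : 'rV[R]_m := xget 0 [set a | optimal_coeff x a].

Definition interpolant (f : H) (x : X) : R :=
  \sum_(i < m) alpha_star x 0 i * ev f (D i).

Definition interpolation_error : \bar R :=
  ess_sup mu (fun x => ereal_sup
    [set (`|ev f x - interpolant f x|)%:E | f in unit_ball]).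

End Interpolation.

(* The sets of m points are enumerated injectively; m = 0 is the empty set. *)
Definition interpolation_width (n : nat) : \bar R :=
  ereal_inf [set e | exists m (D : 'I_m -> X),
    [/\ (m <= n)%N, injective D & e = interpolation_error D]].

End Widths.

(* Main.v *)
(* All widths are compared with the entropy numbers, of order n^(-1/alpha).

   Upper bound for d_n.  After discretization H is Euclidean and the L_oo norm is
   a seminorm q with dual ball K = {h | <h, u> <= q u}.  Duality of entropy
   bounds the covering numbers of K in the Euclidean norm by those of the unit
   ball for q.  Chaining with a random n-row sign matrix G then shows that the
   vectors of K annihilated by G have norm O(n^(-1/alpha)), and by Hahn-Banach
   this is the distance for q from the unit ball to the span of the rows of G.

   Lower bounds.  Let f range over the unit ball of H and the common kernel of n
   linear functionals.  If |f|_2 <= del there, then Carl's multiscale argument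
   (the widths at the levels 2^j <= n being O(2^(-j/alpha)) by the first part)
   covers the unit ball in L_2 with 2^(O(n)) balls of radius little more than
   del, so the lower bound on e_n(L_2) forces del >= c n^(-1/alpha).  Taking the
   functionals f |-> int f g_i for g_i spanning an arbitrary subspace of L_oo
   bounds d_n from below.  Taking point evaluations at D and adjoining the
   functions found so far yields orthonormal f_1, ..., f_n vanishing on D with
   |f_j|_2 >= c n^(-1/alpha).  The squared pointwise interpolation error is at
   least sum_j f_j(x)^2, whose integral is at least c^2 n^(1 - 2/alpha): this is
   the gap n^(1/2). *)

Require Import Defs.
From HB Require Import structures.
From mathcomp Require Import all_boot all_order all_algebra.
From mathcomp Require Import all_classical all_reals all_analysis.
From mathcomp Require Import measurable_realfun ess_sup_inf.
From mathcomp Require Import ring lra zify.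

Set Implicit Arguments.
Unset Strict Implicit.
Unset Printing Implicit Defensive.
Import Order.TTheory GRing.Theory Num.Theory.
Import numFieldNormedType.Exports.
Local Open Scope classical_set_scope.
Local Open Scope ring_scope.

(** * Inner products and orthonormal families *)

(** The discretization has a dimension [M] that depends on [n] in an uncontrolled way, so no
    constant may depend on [M]; the convex geometry enters only through covering numbers. Random
    signs have a finite sample space: probabilities are counts, and the concentration estimates are
    finite sums of exponentials.

    The lower bounds rest on functionals rather than subspaces, since vanishing under [n]
    functionals covers both orthogonality to a subspace and vanishing at the points of D. Carl's
    inequality in its usual form compares suprema of weighted sequences and says nothing about a
    single [n]. Here the widths at all lower levels are already bounded above, so with O([a n]) bits
    the multiscale error is at most a constant times [2^-a n^(-1/alpha)], whereas the entropy stays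
    above a constant times [(a n)^(-1/alpha)]. For a fixed large [a] the error is at most half of
    the entropy bound, and the other half must come from [del]. *)

Section InnerProduct.
Context {R : realType} {V : lmodType R} (b : {dot V for idfun}).
Implicit Types (x y u v : V) (U E : seq V).

Lemma dotC x y : b x y = b y x.
Proof. by rewrite hermC expr0 mul1r. Qed.

Lemma dotZl a x y : b (a *: x) y = a * b x y.
Proof. by rewrite linearZl_LR. Qed.

Lemma dotZr a x y : b x (a *: y) = a * b x y.
Proof. by rewrite dotC dotZl dotC. Qed.

Lemma dotDl x y u : b (x + y) u = b x u + b y u.
Proof. exact: linearDl. Qed.

Lemma dotDr x y u : b u (x + y) = b u x + b u y.
Proof. exact: linearDr. Qed.

Lemma dotBl x y u : b (x - y) u = b x u - b y u.
Proof. exact: linearBl. Qed.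

Lemma dotBr x y u : b u (x - y) = b u x - b u y.
Proof. exact: linearBr. Qed.

Lemma dot_ge0 x : 0 <= b x x.
Proof.
have [->|/neq0_dnorm_gt0 /ltW //] := eqVneq x 0.
by rewrite linear0l.
Qed.

Definition enorm x := Num.sqrt (b x x).

Lemma enorm_ge0 x : 0 <= enorm x. Proof. exact: sqrtr_ge0. Qed.

Lemma sqr_enorm x : enorm x ^+ 2 = b x x.
Proof. by rewrite sqr_sqrtr// dot_ge0. Qed.

Lemma enorm0 : enorm 0 = 0.
Proof. by rewrite /enorm linear0l sqrtr0. Qed.

Lemma enorm_eq0 x : enorm x = 0 -> x = 0.
Proof.
move=> x0; apply/eqP; apply: contraT => /(neq0_dnorm_gt0 (s := b)).
by rewrite -sqr_enorm x0 expr0n ltxx.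
Qed.

Lemma enormZ a x : enorm (a *: x) = `|a| * enorm x.
Proof.
rewrite /enorm dotZl dotZr mulrA -expr2.
by rewrite sqrtrM ?sqr_ge0// sqrtr_sqr.
Qed.

Lemma enormN x : enorm (- x) = enorm x.
Proof. by rewrite -scaleN1r enormZ normrN1 mul1r. Qed.

Lemma dotDD x y : b (x + y) (x + y) = b x x + 2 * b x y + b y y.
Proof. by rewrite dotDl !dotDr (dotC y x); ring. Qed.

Lemma cauchy_schwarz x y : b x y <= enorm x * enorm y.
Proof.
have [->|x0] := eqVneq x 0; first by rewrite linear0l enorm0 mul0r.
have [->|y0] := eqVneq y 0; first by rewrite linear0r enorm0 mulr0.
have nx : 0 < enorm x.
  by rewrite lt_neqAle enorm_ge0 andbT eq_sym; apply: contra_neq x0 => /enorm_eq0.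
have ny : 0 < enorm y.
  by rewrite lt_neqAle enorm_ge0 andbT eq_sym; apply: contra_neq y0 => /enorm_eq0.
have := dot_ge0 (enorm y *: x - enorm x *: y).
have -> : b (enorm y *: x - enorm x *: y) (enorm y *: x - enorm x *: y) =
    2 * (enorm x * enorm y) * (enorm x * enorm y - b x y).
  rewrite dotBl !dotBr !(dotZl, dotZr) (dotC y x) -!sqr_enorm; ring.
move=> h.
have : 0 < enorm x * enorm y by exact: mulr_gt0.
nra.
Qed.

Lemma cauchy_schwarz_norm x y : `|b x y| <= enorm x * enorm y.
Proof.
rewrite ler_norml cauchy_schwarz andbT lerNl.
by rewrite -linearNl (le_trans (cauchy_schwarz _ _))// enormN.
Qed.

Lemma enormD x y : enorm (x + y) <= enorm x + enorm y.
Proof.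
rewrite -(@ler_pXn2r _ 2) ?nnegrE ?addr_ge0 ?enorm_ge0//.
rewrite sqr_enorm dotDD sqrrD !sqr_enorm.
by have := cauchy_schwarz x y; lra.
Qed.

Lemma enorm_sum (I : Type) (r : seq I) (P : pred I) (F : I -> V) :
  enorm (\sum_(i <- r | P i) F i) <= \sum_(i <- r | P i) enorm (F i).
Proof.
elim/big_rec2 : _ => [|i y x _ h]; first by rewrite enorm0.
by rewrite (le_trans (enormD _ _))// lerD2l.
Qed.

Lemma enorm_normalize x : x != 0 -> enorm ((enorm x)^-1 *: x) = 1.
Proof.
move=> x0; have nx : enorm x != 0 by apply: contra_neq x0 => /enorm_eq0.
by rewrite enormZ ger0_norm ?invr_ge0 ?enorm_ge0// mulVf.
Qed.

Definition perp U x := forall u, u \in U -> b x u = 0.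

Definition oproj U x := \sum_(u <- U) b x u *: u.

Lemma oproj_cons u U x : oproj (u :: U) x = b x u *: u + oproj U x.
Proof. by rewrite /oproj big_cons. Qed.

Lemma perp_proj_dot U x y : perp U y -> b (oproj U x) y = 0.
Proof.
move=> Uy; rewrite linear_sumlz big_seq big1// => u uU /=.
by rewrite dotZl dotC Uy// mulr0.
Qed.

Lemma orthonormal_cons u U : orthonormal b (u :: U) <->
  [/\ b u u = 1, perp U u & orthonormal b U].
Proof.
rewrite /orthonormal/= !andbT; split.
  move=> /andP[/andP[/eqP uu ->] /andP[/allP uU ->]]; split => // v vU.
  by apply/eqP/uU.
move=> [uu uU /andP[-> ->]]; rewrite uu eqxx !andbT/=.
by apply/allP => v /uU /eqP.
Qed.

Lemma dot_proj U x v : orthonormal b U -> v \in U -> b (oproj U x) v = b x v.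
Proof.
elim: U => // u U IH /orthonormal_cons[uu uU oU].
rewrite inE oproj_cons dotDl dotZl => /predU1P[->|vU].
  by rewrite uu mulr1 perp_proj_dot ?addr0.
by rewrite uU// mulr0 add0r IH.
Qed.

Lemma perp_subproj U x : orthonormal b U -> perp U (x - oproj U x).
Proof. by move=> oU u uU; rewrite dotBl dot_proj// subrr. Qed.

Lemma perp_fixed U x y : oproj U x = x -> perp U y -> b y x = 0.
Proof. by move=> <- Uy; rewrite dotC perp_proj_dot. Qed.

Lemma pythagoras U x : orthonormal b U ->
  b x x = b (oproj U x) (oproj U x) + b (x - oproj U x) (x - oproj U x).
Proof.
move=> oU; have h : b (oproj U x) (x - oproj U x) = 0.
  by apply: perp_proj_dot; exact: perp_subproj.
have -> : b x x = b (oproj U x + (x - oproj U x)) (oproj U x + (x - oproj U x)).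
  by rewrite subrKC.
by rewrite (dotDD (oproj U x)) h mulr0 addr0.
Qed.

Lemma enorm_proj_le U x : orthonormal b U -> enorm (oproj U x) <= enorm x.
Proof.
by move=> oU; rewrite ler_wsqrtr// (pythagoras x oU) lerDl dot_ge0.
Qed.

Lemma enorm_subproj_le U x : orthonormal b U -> enorm (x - oproj U x) <= enorm x.
Proof.
by move=> oU; rewrite ler_wsqrtr// [leRHS](pythagoras x oU) lerDr dot_ge0.
Qed.

Lemma orthonormal_nth U i j : orthonormal b U -> (i < size U)%N ->
  (j < size U)%N -> b U`_i U`_j = (i == j)%:R.
Proof.
elim: U i j => // u U IH [|i] [|j] /orthonormal_cons[uu uU oU]//= iU jU.
- by rewrite uU ?mem_nth.
- by rewrite dotC uU ?mem_nth.
- by rewrite IH.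
Qed.

Lemma orthonormal_catl E U : orthonormal b (E ++ U) -> orthonormal b E.
Proof.
elim: E => //= e E IH /orthonormal_cons[ee eEU /IH oE].
by apply/orthonormal_cons; split => // v vE; apply: eEU; rewrite mem_cat vE.
Qed.

Lemma orthonormal_cat_perp E U e : orthonormal b (E ++ U) -> e \in E -> perp U e.
Proof.
elim: E => //= a E IH /orthonormal_cons[_ aEU oEU].
rewrite inE => /predU1P[-> u uU|/IH]; last exact.
by rewrite aEU// mem_cat uU orbT.
Qed.

(** Lying in the span of [E ++ U] is expressed as being fixed by the projection. Only the new
    vectors [E] are counted, so in Carl's argument a level with few functionals costs few
    dimensions, however long [U] has become. *)
Lemma gram_schmidt U (vs : seq V) : orthonormal b U ->
  exists E, [/\ (size E <= size vs)%N, orthonormal b (E ++ U) &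
    forall v, v \in vs -> oproj (E ++ U) v = v].
Proof.
move=> oU; elim: vs => [|v vs [E [sE oE hE]]]; first by exists [::].
pose r := v - oproj (E ++ U) v.
have [r0|r0] := eqVneq r 0.
  exists E; split => //; first exact: leqW.
  move=> w; rewrite inE => /predU1P[->|/hE//].
  by apply/esym/eqP; rewrite -subr_eq0; apply/eqP.
have nr : enorm r != 0 by apply: contra_neq r0 => /enorm_eq0.
have Pr : perp (E ++ U) r by exact: perp_subproj.
set e := (enorm r)^-1 *: r.
have Pe : perp (E ++ U) e by move=> u uE; rewrite dotZl Pr// mulr0.
have ee : b e e = 1 by rewrite -sqr_enorm enorm_normalize// expr1n.
exists (e :: E); split => //=; first by apply/orthonormal_cons; split.
move=> w; rewrite inE oproj_cons => /predU1P[->|wvs].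
  suff -> : b v e = enorm r.
    by rewrite scalerA divff// scale1r addrC /r addrC subrK.
  rewrite -(subrK (oproj (E ++ U) v) v) -/r dotDl perp_proj_dot// addr0.
  by rewrite dotZr -sqr_enorm expr2 mulrA mulVf// mul1r.
by rewrite hE// dotC (perp_fixed (hE _ wvs))// scale0r add0r.
Qed.

End InnerProduct.

(** * The Euclidean inner product on row vectors *)

Section RowVectors.
Context {R : realType}.

Definition rowdot {m} (x y : 'rV[R]_m) : R := \sum_(i < m) x 0 i * y 0 i.

Lemma rowdot_bilinear m :
  bilinear_for (GRing.Scale.Law.clone _ _ *%R _)
    (GRing.Scale.Law.clone _ _ *%R _) (@rowdot m).
Proof.
split => [x a u v|x a u v]; rewrite /rowdot /= mulr_sumr -big_split/=;
  by apply: eq_bigr => i _; rewrite !mxE; ring.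
Qed.

HB.instance Definition _ m := bilinear_isBilinear.Build R _ _ _ _ _
  (@rowdot m) (@rowdot_bilinear m).

Lemma rowdot_sym m (x y : 'rV[R]_m) :
  rowdot x y = (-1) ^+ false * idfun (rowdot y x).
Proof.
by rewrite expr0 mul1r /rowdot; apply: eq_bigr => i _; rewrite mulrC.
Qed.

HB.instance Definition _ m := isHermitianSesquilinear.Build R _ _ _
  (@rowdot m) (@rowdot_sym m).

Lemma rowdot_gt0 m (x : 'rV[R]_m) : x != 0 -> 0 < rowdot x x.
Proof.
move=> x0; rewrite lt_neqAle sumr_ge0 ?andbT; last first.
  by move=> i _; rewrite -expr2 sqr_ge0.
rewrite eq_sym; apply: contra_neq x0 => /eqP.
rewrite psumr_eq0 => [/allP x0|i _]; last by rewrite -expr2 sqr_ge0.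
apply/rowP => i; rewrite mxE.
by have := x0 i (mem_index_enum _); rewrite mulf_eq0 orbb => /eqP.
Qed.

HB.instance Definition _ m := isDotProduct.Build R _ (@rowdot m) (@rowdot_gt0 m).

Definition rdot m : {dot 'rV[R]_m for idfun} := @rowdot m.

End RowVectors.

(** * Hahn-Banach for sublinear functions on row vectors *)

Section Sublinear.
Context {R : realType}.

Definition sublinear {V : lmodType R} (p : V -> R) : Prop :=
  (forall x y, p (x + y) <= p x + p y) /\
  (forall (a : R) x, 0 < a -> p (a *: x) = a * p x).

Lemma sublinear0 (V : lmodType R) (p : V -> R) : sublinear p -> p 0 = 0.
Proof. by move=> [_ /(_ 2 0)]; rewrite scaler0 => /(_ ltac:(lra)) h; lra. Qed.

Lemma sublinear_opp (V : lmodType R) (p : V -> R) x :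
  sublinear p -> 0 <= p x + p (- x).
Proof.
by move=> sp; rewrite -(sublinear0 sp) -(subrr x); apply: (sp.1 x (- x)).
Qed.

(* One step of Hahn-Banach: [p] is lowered so as to become additive along [v];
   since it only decreases, additivity along earlier directions persists. *)
Lemma sublinear_straighten (V : lmodType R) (p : V -> R) (v : V) :
  sublinear p -> exists p' : V -> R,
    [/\ sublinear p', forall x, p' x <= p x & p' (- v) <= - p v].
Proof.
move=> sp; have [pD pZ] := sp.
(* The infimum over [t] is the largest sublinear function below [p] whose value at [- v] is at most
   [- p v]; taking [t = 1] at [- v] gives that value. *)
pose S x := [set p (x + t *: v) - t * p v | t in [set t : R | 0 <= t]].
have S0 x : S x !=set0 by exists (p (x + 0 *: v) - 0 * p v); exists 0 => /=.
have Slb x : lbound (S x) (- p (- x)).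
  move=> _ [t /= t0 <-].
  have : p (t *: v) <= p (x + t *: v) + p (- x).
    by apply: le_trans (pD _ _); rewrite addrAC subrr add0r.
  have -> : p (t *: v) = t * p v.
    move: t0; rewrite le_eqVlt => /predU1P[<-|/pZ //].
    by rewrite scale0r mul0r (sublinear0 sp).
  by lra.
have Sinf x : has_inf (S x) by split => //; exists (- p (- x)).
pose p' x := inf (S x).
have p'le x t : 0 <= t -> p' x <= p (x + t *: v) - t * p v.
  by move=> t0; apply: ge_inf; [exact: (Sinf x).2 | exists t].
have p'ge x y : (forall t, 0 <= t -> y <= p (x + t *: v) - t * p v) -> y <= p' x.
  by move=> h; apply: lb_le_inf => // _ [t /= t0 <-]; exact: h.
exists p'; split; last 2 first.
- by move=> x; apply: le_trans (p'le x 0 _) _ => //; rewrite scale0r addr0; lra.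
- apply: le_trans (p'le (- v) 1 _) _ => //.
  by rewrite scale1r addNr (sublinear0 sp); lra.
have p'Z (a : R) x : 0 < a -> p' (a *: x) <= a * p' x.
  move=> a0; rewrite -ler_pdivrMl//; apply: (p'ge) => t t0.
  rewrite ler_pdivrMl// mulrBr -pZ// scalerDr scalerA mulrA.
  by apply: p'le; rewrite mulr_ge0// ltW.
split=> [x y|a x a0].
  rewrite -lerBlDr; apply: (p'ge) => s s0; rewrite lerBlDr -lerBlDl.
  apply: (p'ge) => t t0.
  have := p'le (x + y) (s + t) (addr_ge0 s0 t0).
  have := pD (x + s *: v) (y + t *: v).
  by rewrite addrACA -scalerDl; lra.
apply/eqP; rewrite eq_le p'Z//=.
have /p'Z : 0 < a^-1 by rewrite invr_gt0.
move=> /(_ (a *: x)); rewrite scalerA mulVf ?gt_eqF// scale1r.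
by rewrite ler_pdivlMl.
Qed.

Lemma sublinear_straighten_seq (V : lmodType R) (p : V -> R) (vs : seq V) :
  sublinear p -> exists p' : V -> R,
    [/\ sublinear p', forall x, p' x <= p x &
        forall v, v \in vs -> p' v + p' (- v) = 0].
Proof.
elim: vs p => [|v vs IH] p sp; first by exists p.
have [p1 [sp1 p1p p1v]] := sublinear_straighten v sp.
have [p2 [sp2 p2p p2v]] := IH _ sp1.
exists p2; split => // [x|w]; first exact: le_trans (p2p x) (p1p x).
rewrite inE => /predU1P[->|/p2v //].
have := sublinear_opp v sp2; have := p2p v; have := p2p (- v); have := p1p v.
by lra.
Qed.

(** Straightening along [f] first pins the value at [f]. Straightening along the standard basis then
    makes the minorant odd in every basis direction; such directions form a subspace on which it is
    linear, and its values on the basis are the coordinates of [h]. *)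
Lemma hahn_banach_row m (p : 'rV[R]_m -> R) (f : 'rV[R]_m) : sublinear p ->
  exists h : 'rV[R]_m, (forall x, rdot m h x <= p x) /\ rdot m h f = p f.
Proof.
move=> sp.
have [p1 [sp1 p1p p1f]] := sublinear_straighten f sp.
have [p2 [sp2 p2p p2v]] :=
  sublinear_straighten_seq [seq delta_mx 0 i | i <- enum 'I_m] sp1.
have [pD pZ] := sp2.
pose add x := p2 x + p2 (- x) = 0.
have addP x y : add x -> p2 (x + y) = p2 x + p2 y.
  rewrite /add => x0; apply/eqP; rewrite eq_le pD/=.
  have := pD (x + y) (- x); rewrite addrAC subrr add0r; lra.
have addS x y : add x -> add y -> add (x + y).
  move=> ax ay; rewrite /add opprD !addP ?/add ?opprK//; last first.
    by rewrite addrC.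
  by move: ax ay; rewrite /add; lra.
have addZ (a : R) x : add x -> add (a *: x) /\ p2 (a *: x) = a * p2 x.
  have pos (c : R) y : add y -> 0 <= c -> p2 (c *: y) = c * p2 y.
    move=> ay; rewrite le_eqVlt => /predU1P[<-|/pZ //].
    by rewrite scale0r mul0r (sublinear0 sp2).
  move=> ax; have ax' : add (- x) by rewrite /add opprK addrC.
  have [a0|a0] := leP 0 a.
    rewrite /add -scalerN !pos//; split => //.
    by move: ax; rewrite /add -mulrDr => ->; rewrite mulr0.
  have na : 0 <= - a by lra.
  have -> : a *: x = (- a) *: (- x) by rewrite scalerN scaleNr opprK.
  rewrite /add -scalerN opprK !pos// -mulrDr; split; last by move: ax; rewrite /add; nra.
  by move: ax'; rewrite /add opprK => ->; rewrite mulr0.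
have add_delta i : add (delta_mx 0 i).
  by apply: p2v; apply: map_f; rewrite mem_enum.
pose h := \row_i p2 (delta_mx 0 i); exists h.
have hE x : rdot m h x = p2 x.
  suff [_ ->] : add x /\ p2 x = \sum_i x 0 i * p2 (delta_mx 0 i).
    by apply: eq_bigr => i _; rewrite mxE mulrC.
  rewrite [in add _](row_sum_delta x) {2}(row_sum_delta x).
  elim/big_rec2: _ => [|i y z _ [az e]].
    by rewrite /add oppr0 (sublinear0 sp2) addr0.
  have [h1 h2] := addZ (x 0 i) _ (add_delta i).
  by split; [exact: addS | rewrite addP// h2 e].
split=> [x|]; rewrite hE; first exact: le_trans (p2p x) (p1p x).
have := sublinear_opp f sp2.
have := p2p f; have := p2p (- f); have := p1p f; lra.
Qed.

Definition seminorm {V : lmodType R} (q : V -> R) : Prop :=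
  (forall x y, q (x + y) <= q x + q y) /\
  (forall (a : R) x, q (a *: x) = `|a| * q x).

Section Seminorm.
Context {V : lmodType R} {q : V -> R}.
Hypothesis sq : seminorm q.

Lemma seminormD x y : q (x + y) <= q x + q y. Proof. exact: sq.1. Qed.

Lemma seminormZ a x : q (a *: x) = `|a| * q x. Proof. exact: sq.2. Qed.

Lemma seminormN x : q (- x) = q x.
Proof. by rewrite -scaleN1r seminormZ normrN1 mul1r. Qed.

Lemma seminorm0 : q 0 = 0.
Proof. by rewrite -(scale0r 0) seminormZ normr0 mul0r. Qed.

Lemma seminorm_ge0 x : 0 <= q x.
Proof.
have := seminormD x (- x); rewrite subrr seminorm0 seminormN; lra.
Qed.

Lemma seminormB x y : q (x - y) <= q x + q y.
Proof. by rewrite -(seminormN y) seminormD. Qed.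

Lemma seminorm_dist x y z : q (x - z) <= q (x - y) + q (y - z).
Proof. by rewrite (le_trans _ (seminormD _ _))// addrA subrK. Qed.

End Seminorm.

(** Covering numbers on a logarithmic scale: the sizes of nets of sums multiply, so [L] adds up, and
    [e_n] corresponds to [L = n - 1]. *)
Definition covered {V : choiceType} (A : set V) (dist : V -> V -> R) (t : R)
    (L : nat) : Prop :=
  exists2 s : seq V, (size s <= 2 ^ L)%N &
    forall x, A x -> exists2 y, y \in s & dist x y <= t.

End Sublinear.

(** * Nets of Euclidean balls *)

Section BallCovering.
Context {R : realType}.

Lemma sum_half_pow n : \sum_(k < n) (2^-1 : R) ^+ k <= 2.
Proof.
suff -> : \sum_(k < n) (2^-1 : R) ^+ k = 2 - 2 * 2^-1 ^+ n.
  by rewrite lerBlDr lerDl mulr_ge0// exprn_ge0// invr_ge0.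
elim: n => [|n IH]; first by rewrite big_ord0 expr0; ring.
by rewrite big_ord_recr/= IH exprS; field.
Qed.

(* Weighting a lattice point [z] by [2 ^ - sum |z_i|] makes the count of the
   points with [sum |z_i| <= S] a product of geometric series. *)
Lemma card_signed_le m N S :
  (#|[pred f : {ffun 'I_m -> bool * 'I_N} | \sum_i (f i).2 <= S]| <=
   2 ^ (S + 2 * m))%N.
Proof.
rewrite -(@ler_nat R) -sumr_const.
pose w (z : bool * 'I_N) : R := 2^-1 ^+ z.2.
have w0 z : 0 <= w z by rewrite exprn_ge0// invr_ge0.
apply: (@le_trans _ _ (\sum_(f : {ffun 'I_m -> bool * 'I_N})
    2 ^+ S * \prod_(i < m) w (f i))).
  rewrite [leLHS]big_mkcond/=; apply: ler_sum => f _; case: ifPn => [|_].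
    rewrite inE /w prodrXr => fS.
    rewrite exprVn ler_pdivlMr ?exprn_gt0// mul1r.
    by rewrite ler_eXn2l ?ltr1n.
  by rewrite mulr_ge0 ?exprn_ge0// prodr_ge0.
rewrite -mulr_sumr -(bigA_distr_bigA (fun=> w))/= natrX exprD ler_wpM2l ?exprn_ge0//.
rewrite prodr_const card_ord exprM lerXn2r ?nnegrE ?sumr_ge0//.
have -> : \sum_z w z = \sum_(s : bool) \sum_(k < N) (2^-1 : R) ^+ k.
  by rewrite (pair_bigA _ (fun (_ : bool) (k : 'I_N) => 2^-1 ^+ k)).
by rewrite big_bool/=; have := sum_half_pow N; lra.
Qed.

Definition unit_row m : set 'rV[R]_m := [set x | enorm (rdot m) x <= 1].

Lemma rdotE m (x y : 'rV[R]_m) : rdot m x y = \sum_(i < m) x 0 i * y 0 i.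
Proof. by []. Qed.

Lemma sqr_enorm_row m (x : 'rV[R]_m) :
  enorm (rdot m) x ^+ 2 = \sum_(i < m) x 0 i ^+ 2.
Proof. by rewrite sqr_enorm rdotE; apply: eq_bigr => i _; rewrite expr2. Qed.

Lemma le_enorm_row m (x : 'rV[R]_m) c : 0 <= c ->
  \sum_(i < m) x 0 i ^+ 2 <= c ^+ 2 -> enorm (rdot m) x <= c.
Proof.
move=> c0; rewrite -sqr_enorm_row.
by rewrite ler_pXn2r// nnegrE enorm_ge0.
Qed.

(** Each coordinate is rounded towards 0 on the grid of mesh [1 / h], [h = 2 sqrt m]. The squared
    error is at most [m / h^2 = 1/4], and the integers [z_i] obtained satisfy
    [sum |z_i| <= sum z_i^2 <= h^2 = 4 m], so [card_signed_le] gives [4 m + 2 m] bits. *)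
Lemma covered_unit_row_half m :
  covered (@unit_row m) (fun x y => enorm (rdot m) (x - y)) 2^-1 (6 * m).
Proof.
pose h : R := 2 * Num.sqrt m%:R.
pose A := [pred f : {ffun 'I_m -> bool * 'I_(2 * m).+1} | \sum_i (f i).2 <= 4 * m]%N.
pose pt (f : {ffun 'I_m -> bool * 'I_(2 * m).+1}) : 'rV[R]_m :=
  \row_i ((-1) ^+ (f i).1 * ((f i).2%:R / h)).
exists [seq pt f | f <- enum A].
  rewrite size_map -cardE (leq_trans (card_signed_le _ _ _))//.
  by rewrite leq_exp2l// -mulnDl.
move=> x /= x1; have sx : \sum_(i < m) x 0 i ^+ 2 <= 1.
  by rewrite -sqr_enorm_row expr_le1// enorm_ge0.
have h0 : 0 <= h by rewrite mulr_ge0.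
pose k i : nat := Num.truncn (h * `|x 0 i|).
have kx i : (k i)%:R <= h * `|x 0 i| < (k i)%:R + 1.
  by rewrite natr1 truncn_itv// mulr_ge0.
have hx i : `|x 0 i| <= 1.
  rewrite -(@ler_pXn2r _ 2) ?nnegrE// expr1n real_normK ?num_real//.
  by apply: le_trans sx; rewrite (bigD1 i)//= lerDl sumr_ge0// => j _; rewrite sqr_ge0.
have hm i : h * `|x 0 i| <= (2 * m)%:R.
  rewrite (le_trans (ler_wpM2l h0 (hx i)))// mulr1 natrM ler_wpM2l//.
  have m1 : 1 <= (m%:R : R) by rewrite ler1n (leq_ltn_trans _ (ltn_ord i)).
  rewrite -(@ler_pXn2r _ 2) ?nnegrE ?sqrtr_ge0// sqr_sqrtr//.
  by rewrite expr2 ler_peMl.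
have km i : (k i < (2 * m).+1)%N.
  by rewrite ltnS -(@ler_nat R) (le_trans _ (hm i))//; case/andP: (kx i).
pose f : {ffun 'I_m -> bool * 'I_(2 * m).+1} :=
  [ffun i => (x 0 i < 0, Ordinal (km i))].
have hh : h ^+ 2 = 4 * m%:R by rewrite exprMn sqr_sqrtr// -natrX.
exists (pt f).
  apply: map_f; rewrite mem_enum inE.
  rewrite -(@ler_nat R) natr_sum natrM.
  apply: (@le_trans _ _ (\sum_(i < m) (h * `|x 0 i|) ^+ 2)).
    apply: ler_sum => i _; rewrite ffunE/=.
    have [k1 _] := andP (kx i).
    apply: (@le_trans _ _ ((k i)%:R ^+ 2)).
      by rewrite -natrX ler_nat -{1}[k i]muln1 expnS expn1 leq_mul2l; case: (k i).
    by rewrite lerXn2r ?nnegrE// mulr_ge0.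
  under eq_bigr do rewrite exprMn real_normK ?num_real//.
  by rewrite -mulr_sumr hh ler_piMr// mulr_ge0.
apply: le_enorm_row; first by rewrite invr_ge0.
apply: (@le_trans _ _ (\sum_(i < m) (h ^+ 2)^-1)); last first.
  rewrite sumr_const card_ord -[leLHS]mulr_natr hh.
  have [->|m0] := eqVneq (m%:R : R) 0; first by rewrite mulr0; lra.
  have -> : (4 * m%:R)^-1 * m%:R = 4^-1 :> R by field.
  by lra.
apply: ler_sum => i _; rewrite !mxE ffunE/=.
have hp : 0 < h.
  by rewrite mulr_gt0// sqrtr_gt0 ltr0n (leq_ltn_trans _ (ltn_ord i)).
have [k1 k2] := andP (kx i).
rewrite -exprVn -real_normK ?num_real// lerXn2r ?nnegrE ?invr_ge0//.
have e : `|(`|x 0 i| - (k i)%:R / h)| <= h^-1.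
  have -> : `|x 0 i| - (k i)%:R / h = (h * `|x 0 i| - (k i)%:R) / h.
    by rewrite mulrBl mulrAC divff ?mul1r// gt_eqF.
  rewrite ger0_norm ?divr_ge0 ?subr_ge0// ler_piMl ?invr_ge0//.
  by lra.
have [x0|x0] := ltP (x 0 i) 0; last first.
  by rewrite expr0 mul1r -{1}(ger0_norm x0).
rewrite expr1 mulN1r opprK -normrN opprD.
by move: e; rewrite (ltr0_norm x0).
Qed.

(** The remainder after a net of radius 1/2, doubled, is again in the unit ball, so each halving of
    the radius costs another [6 m] bits. *)
Lemma covered_unit_row m i : covered (@unit_row m)
  (fun x y => enorm (rdot m) (x - y)) (2^-1 ^+ i) (6 * m * i).
Proof.
elim: i => [|i [s ss hs]].
  exists [:: 0]; first by rewrite muln0.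
  by move=> x x1; exists 0; rewrite ?mem_head// subr0.
have [s1 ss1 hs1] := covered_unit_row_half m.
exists [seq y + 2^-1 *: z | y <- s1, z <- s].
  by rewrite size_allpairs mulnS expnD leq_mul.
move=> x x1; have [y ys1 xy] := hs1 _ x1.
have [|z zs xyz] := hs (2 *: (x - y)).
  by rewrite /unit_row/= enormZ ger0_norm//; lra.
exists (y + 2^-1 *: z); first by apply/allpairsP; exists (y, z).
have -> : x - (y + 2^-1 *: z) = 2^-1 *: (2 *: (x - y) - z).
  by rewrite scalerBr scalerA mulVf// scale1r opprD addrA.
by rewrite enormZ ger0_norm// exprS ler_wpM2l.
Qed.

End BallCovering.

(** * Random sign matrices *)

Section RandomSigns.
Context {R : realType}.

(** The exponent is not sharp, but it follows from elementary bounds: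
    [e^z <= 1 / (1 - z) <= 1 + z + 2 z^2] for [|z| <= 1/2], and [y <= 2 y^2] for [y >= 1/2]. *)
Lemma cosh_le_expR (y : R) : expR y + expR (- y) <= 2 * expR (2 * y ^+ 2).
Proof.
wlog y0 : y / 0 <= y.
  move=> h; have [/h //|y0] := leP 0 y.
  by have := h (- y); rewrite opprK sqrrN addrC; apply; lra.
have [y1|y1] := leP (2^-1) y.
  have h1 : expR y <= expR (2 * y ^+ 2) by rewrite ler_expR; nra.
  have h2 : expR (- y) <= expR (2 * y ^+ 2) by rewrite ler_expR; nra.
  by lra.
have inv_le (z : R) : - 2^-1 <= z -> z <= 2^-1 -> expR z <= 1 + z + 2 * z ^+ 2.
  move=> z1 z2; have hz : 0 < 1 - z by lra.
  have : expR z * (1 - z) <= 1.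
    by rewrite -[leRHS](expRxMexpNx_1 z) ler_pM2l ?expR_gt0// expR_ge1Dx.
  rewrite -ler_pdivlMr// div1r => /le_trans; apply.
  rewrite invf_ple ?posrE//; last by nra.
  rewrite -[leLHS]mul1r ler_pdivrMr; nra.
have h1 := inv_le y ltac:(lra) ltac:(lra).
have h2 := inv_le (- y) ltac:(lra) ltac:(lra).
have := expR_ge1Dx (2 * y ^+ 2); rewrite sqrrN in h2; nra.
Qed.

Section PartialSums.
Context {M : nat} (v : 'rV[R]_M).
Implicit Types (w : {ffun 'I_M -> bool}) (k : nat).

(** The sample space keeps all [M] signs while [k] varies, so induction on [k] does not change the
    type of [w]. *)
Definition signed_psum k w : R :=
  \sum_(l < M | (l < k)%N) (-1) ^+ (w l) * v 0 l.

Definition sqr_psum k : R := \sum_(l < M | (l < k)%N) v 0 l ^+ 2.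

Lemma psum0 w : signed_psum 0 w = 0.
Proof. by rewrite /signed_psum big_pred0. Qed.

Lemma ord_ltS (j l : 'I_M) : (l < j.+1)%N && (l != j) = (l < j)%N.
Proof. by rewrite ltnS ltn_neqAle andbC. Qed.

Lemma psumS (j : 'I_M) w :
  signed_psum j.+1 w = (-1) ^+ (w j) * v 0 j + signed_psum j w.
Proof.
by rewrite /signed_psum (bigD1 j)//=; congr (_ + _); apply: eq_bigl => l; rewrite ord_ltS.
Qed.

Lemma sqr_psumS (j : 'I_M) : sqr_psum j.+1 = v 0 j ^+ 2 + sqr_psum j.
Proof.
by rewrite /sqr_psum (bigD1 j)//=; congr (_ + _); apply: eq_bigl => l; rewrite ord_ltS.
Qed.

Lemma sqr_psum_ge0 k : 0 <= sqr_psum k.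
Proof. by rewrite sumr_ge0// => l _; rewrite sqr_ge0. Qed.

Definition flip (j : 'I_M) w : {ffun 'I_M -> bool} := [ffun l => w l (+) (l == j)].

Lemma flipK j : involutive (flip j).
Proof. by move=> w; apply/ffunP => l; rewrite !ffunE -addbA addbb addbF. Qed.

Lemma psum_flip (j : 'I_M) w : signed_psum j (flip j w) = signed_psum j w.
Proof.
apply: eq_bigr => l lj; rewrite ffunE; congr ((-1) ^+ _ * _).
by rewrite (_ : (l == j) = false) ?addbF//; apply/negbTE; rewrite neq_ltn lj.
Qed.

(* Pairing [w] with [flip j w] makes hyperbolic cosines appear. *)
Lemma sum_expR_psumS (j : 'I_M) (c : R) :
  \sum_w expR (c * signed_psum j.+1 w ^+ 2) <=
  expR (c * v 0 j ^+ 2) *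
  \sum_w expR (c * (1 + 8 * c * v 0 j ^+ 2) * signed_psum j w ^+ 2).
Proof.
have e : \sum_w expR (c * signed_psum j.+1 w ^+ 2) =
         \sum_w expR (c * signed_psum j.+1 (flip j w) ^+ 2).
  by rewrite (reindex_inj (inv_inj (flipK j))).
suff : 2 * (\sum_w expR (c * signed_psum j.+1 w ^+ 2)) <=
  2 * (expR (c * v 0 j ^+ 2) *
  \sum_w expR (c * (1 + 8 * c * v 0 j ^+ 2) * signed_psum j w ^+ 2)).
  by rewrite ler_pM2l.
rewrite mulr_natl mulr2n {2}e -big_split/= !mulr_sumr.
apply: ler_sum => w _; rewrite !psumS psum_flip ffunE eqxx addbT.
set s := signed_psum j w; set a := v 0 j; set y := 2 * c * s * a.
have -> : expR (c * ((-1) ^+ w j * a + s) ^+ 2) +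
   expR (c * ((-1) ^+ (~~ w j) * a + s) ^+ 2) =
   expR (c * (s ^+ 2 + a ^+ 2)) * (expR y + expR (- y)).
  rewrite mulrDr -!expRD.
  have -> : c * (s ^+ 2 + a ^+ 2) + y = c * (a + s) ^+ 2 by rewrite /y; ring.
  have -> : c * (s ^+ 2 + a ^+ 2) - y = c * (- a + s) ^+ 2 by rewrite /y; ring.
  by case: (w j) => /=; rewrite expr0 expr1 mul1r mulN1r// addrC.
rewrite (le_trans (ler_wpM2l (expR_ge0 _) (cosh_le_expR y)))//.
rewrite mulrCA ler_pM2l// -!expRD ler_expR /y le_eqVlt; apply/orP; left.
by apply/eqP; ring.
Qed.

(** With [x = c s] and [y = c v_j^2], eliminating the sign [j] gives the exponent
    [y + 2 x (1 + 8 y)], which is at most [2 (x + y)] as soon as [x <= 1/16]: this fixes the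
    threshold. It also lets the hypothesis survive for the enlarged coefficient, since
    [x (1 + 8 y) <= x + y]. *)
Lemma sum_expR_psum_pos k (c : R) : (k <= M)%N -> 0 <= c -> c * sqr_psum k <= 16^-1 ->
  \sum_w expR (c * signed_psum k w ^+ 2) <=
  #|{ffun 'I_M -> bool}|%:R * expR (2 * c * sqr_psum k).
Proof.
elim: k c => [|k IH] c kM c0 ck.
  under eq_bigr do rewrite psum0 expr0n mulr0 expR0.
  by rewrite sumr_const /sqr_psum big_pred0// mulr0 expR0 mulr1.
pose j := Ordinal kM; rewrite (le_trans (sum_expR_psumS j c))//.
move: ck; rewrite (sqr_psumS j) -/(sqr_psum k) => ck.
set a2 := v 0 j ^+ 2 in ck *; have a0 : 0 <= a2 by exact: sqr_ge0.
have s0 := sqr_psum_ge0 k; set s := sqr_psum k in ck s0 *.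
have x0 : 0 <= c * s by exact: mulr_ge0.
have y0 : 0 <= c * a2 by exact: mulr_ge0.
have /IH : 0 <= c * (1 + 8 * c * a2) by nra.
move=> /(_ (ltnW kM)) IH'.
rewrite (le_trans (ler_wpM2l (expR_ge0 _) (IH' _)))//.
  rewrite -/s (_ : _ * s = c * s * (1 + 8 * (c * a2))); last by ring.
  move: x0 y0 (ck); rewrite mulrDr; move: (c * s) (c * a2) => x y *; nra.
rewrite mulrCA ler_wpM2l// -expRD ler_expR -/s.
have : (c * s) * (c * a2) <= 16^-1 * (c * a2) by rewrite ler_wpM2r//; lra.
nra.
Qed.

(** Now the coefficient shrinks to [c (1 - 8 c v_j^2)]. In the same notation the exponent is
    [- y - x (1 - 8 y) / 2], and the loss [4 x y] is absorbed by half of [y]. *)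
Lemma sum_expR_psum_neg k (c : R) : (k <= M)%N -> 0 <= c -> c <= 16^-1 ->
  sqr_psum k <= 1 ->
  \sum_w expR (- c * signed_psum k w ^+ 2) <=
  #|{ffun 'I_M -> bool}|%:R * expR (- c * sqr_psum k / 2).
Proof.
elim: k c => [|k IH] c kM c0 c1 ck.
  under eq_bigr do rewrite psum0 expr0n mulr0 expR0.
  by rewrite sumr_const /sqr_psum big_pred0// mulr0 mul0r expR0 mulr1.
pose j := Ordinal kM; rewrite (le_trans (sum_expR_psumS j (- c)))//.
move: ck; rewrite (sqr_psumS j) -/(sqr_psum k) => ck.
set a2 := v 0 j ^+ 2 in ck *; have a0 : 0 <= a2 by exact: sqr_ge0.
have s0 := sqr_psum_ge0 k; set s := sqr_psum k in ck s0 *.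
have x0 : 0 <= c * s by exact: mulr_ge0.
have y0 : 0 <= c * a2 by exact: mulr_ge0.
have y1 : c * a2 <= 16^-1 by nra.
have /IH : 0 <= c * (1 - 8 * c * a2) by nra.
move=> /(_ (ltnW kM)) IH'.
have -> : - c * (1 + 8 * - c * a2) = - (c * (1 - 8 * c * a2)) by ring.
rewrite (le_trans (ler_wpM2l (expR_ge0 _) (IH' _ _)))//; [by nra|by rewrite -/s; lra|].
rewrite mulrCA ler_wpM2l// -expRD ler_expR -/s.
have : (c * s) * (c * a2) <= 16^-1 * (c * a2) by rewrite ler_wpM2r//; nra.
nra.
Qed.

End PartialSums.

Definition sign_mx {M n} (W : {ffun 'I_n -> {ffun 'I_M -> bool}}) : 'M[R]_(M, n) :=
  \matrix_(l, r) (-1) ^+ (W r l).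

Lemma sqr_enorm_sign_mx M n (W : {ffun 'I_n -> {ffun 'I_M -> bool}}) v :
  enorm (rdot n) (v *m sign_mx W) ^+ 2 = \sum_(r < n) signed_psum v M (W r) ^+ 2.
Proof.
rewrite sqr_enorm_row; apply: eq_bigr => r _; congr (_ ^+ 2).
rewrite !mxE /signed_psum; under [RHS]eq_bigl do rewrite ltn_ord.
by apply: eq_bigr => l _; rewrite !mxE mulrC.
Qed.

Lemma sqr_psumE M (v : 'rV[R]_M) : sqr_psum v M = enorm (rdot M) v ^+ 2.
Proof. by rewrite sqr_enorm_row /sqr_psum; apply: eq_bigl => l; rewrite ltn_ord. Qed.

(** Crude and dependent on [M]; it is meant for the last remainder of the chaining, which is small
    enough to absorb the factor [M]. *)
Lemma sign_mx_bound M n (W : {ffun 'I_n -> {ffun 'I_M -> bool}}) v :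
  enorm (rdot n) (v *m sign_mx W) ^+ 2 <= (n * M)%:R * enorm (rdot M) v ^+ 2.
Proof.
rewrite sqr_enorm_row natrM -mulrA mulr_natl.
rewrite -[X in _ <= _ *+ X](card_ord n) -sumr_const.
apply: ler_sum => r _.
have -> : (v *m sign_mx W) 0 r = rdot M v (\row_l (-1) ^+ (W r l)).
  by rewrite mxE rdotE; apply: eq_bigr => l _; rewrite !mxE.
have nM : enorm (rdot M) (\row_l (-1) ^+ (W r l)) ^+ 2 = M%:R :> R.
  rewrite sqr_enorm_row; under eq_bigr do rewrite mxE -signr_odd sqrr_sign.
  by rewrite sumr_const card_ord.
rewrite -nM mulrC -exprMn -real_normK ?num_real// lerXn2r ?nnegrE//.
  by rewrite mulr_ge0 ?enorm_ge0.
exact: cauchy_schwarz_norm.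
Qed.

Lemma sum_prod_rows M n (F : {ffun 'I_M -> bool} -> R) :
  \sum_(W : {ffun 'I_n -> {ffun 'I_M -> bool}}) expR (\sum_(r < n) F (W r)) =
  (\sum_w expR (F w)) ^+ n.
Proof.
under eq_bigr do rewrite expR_sum.
by rewrite -(bigA_distr_bigA (fun=> expR \o F))/= prodr_const card_ord.
Qed.

Let signsT M n := {ffun 'I_n -> {ffun 'I_M -> bool}}.

(** For a vector of norm at most 1, [16^-1] is the largest coefficient that [sum_expR_psum_pos]
    admits. Each of the [n] independent sign vectors contributes a factor [exp (1/8)]. *)
Lemma signs_upper_tail M n (v : 'rV[R]_M) (A : R) : enorm (rdot M) v <= 1 ->
  \sum_(W : signsT M n)
    expR (16^-1 * (enorm (rdot n) (v *m sign_mx W) ^+ 2 - n%:R * A)) <=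
  #|signsT M n|%:R * expR (n%:R * (8^-1 - A / 16)).
Proof.
move=> v1.
have -> : #|signsT M n|%:R * expR (n%:R * (8^-1 - A / 16)) =
  (#|{ffun 'I_M -> bool}|%:R * expR 8^-1) ^+ n * expR (- (n%:R * A / 16)).
  rewrite card_ffun card_ord natrX exprMn -expRM_natl -[RHS]mulrA -expRD.
  by congr (_ * expR _); ring.
under eq_bigr => W _ do rewrite sqr_enorm_sign_mx mulrBr expRD mulr_sumr.
rewrite -mulr_suml (sum_prod_rows _ (fun w => 16^-1 * signed_psum v M w ^+ 2)).
rewrite (_ : - (16^-1 * (n%:R * A)) = - (n%:R * A / 16)); last by ring.
rewrite ler_wpM2r ?expR_ge0//; apply: lerXn2r; rewrite ?nnegrE.
- by rewrite sumr_ge0// => *; exact: expR_ge0.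
- by rewrite mulr_ge0 ?expR_ge0.
have hv : sqr_psum v M <= 1 by rewrite sqr_psumE expr_le1// enorm_ge0.
rewrite (le_trans (sum_expR_psum_pos _ _ _))//; first by lra.
by rewrite ler_wpM2l// ler_expR; lra.
Qed.

Lemma signs_lower_tail M n (v : 'rV[R]_M) : enorm (rdot M) v = 1 ->
  \sum_(W : signsT M n)
    expR (16^-1 * (n%:R / 4 - enorm (rdot n) (v *m sign_mx W) ^+ 2)) <=
  #|signsT M n|%:R * expR (- (n%:R / 64)).
Proof.
move=> v1.
have -> : #|signsT M n|%:R * expR (- (n%:R / 64)) =
  expR (n%:R / 64) * (#|{ffun 'I_M -> bool}|%:R * expR (- (32)^-1)) ^+ n :> R.
  rewrite card_ffun card_ord natrX exprMn mulrCA -expRM_natl -expRD.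
  by congr (_ * expR _); field.
under eq_bigr => W _ do rewrite sqr_enorm_sign_mx mulrBr expRD -mulrN -sumrN mulr_sumr.
rewrite -mulr_sumr (sum_prod_rows _ (fun w => 16^-1 * - signed_psum v M w ^+ 2)).
rewrite (_ : 16^-1 * (n%:R / 4) = n%:R / 64 :> R); last by field.
rewrite ler_wpM2l ?expR_ge0//; apply: lerXn2r; rewrite ?nnegrE.
- by rewrite sumr_ge0// => *; exact: expR_ge0.
- by rewrite mulr_ge0 ?expR_ge0.
have hv : sqr_psum v M = 1 by rewrite sqr_psumE v1 expr1n.
under eq_bigr do rewrite mulrN -mulNr.
rewrite (le_trans (sum_expR_psum_neg _ _ _ _))//; first by rewrite hv.
by rewrite hv ler_wpM2l// ler_expR; lra.
Qed.

End RandomSigns.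

(** * First moment method for sign matrices *)

Section RandomSubspace.
Context {R : realType}.

Lemma sum_seq_le (T : eqType) (s : seq T) (F : T -> R) (c : R) :
  (forall x, x \in s -> F x <= c) -> \sum_(x <- s) F x <= (size s)%:R * c.
Proof.
elim: s => [|a s IH] h; first by rewrite big_nil mul0r.
rewrite big_cons/= -natr1 mulrDl mul1r addrC lerD ?h ?mem_head//.
by apply: IH => x xs; apply: h; rewrite inE xs orbT.
Qed.

(** A violated inequality contributes at least [expR 0 = 1] to the nonnegative sum [Phi G], whereas
    the average of [Phi] over all sign matrices is below 1. The bound [A i] may vary with the level
    because finer levels contain more vectors. *)
Lemma signs_exist n M (S0 : seq 'rV[R]_M) (m : nat) (W : nat -> seq 'rV[R]_M)
    (A : nat -> R) :
  (size S0)%:R * expR (- (n%:R / 64)) +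
    \sum_(i < m) (size (W i))%:R * expR (n%:R * (8^-1 - A i / 16)) < 1 ->
  exists G : {ffun 'I_n -> {ffun 'I_M -> bool}},
    (forall u, u \in S0 ->
      n%:R / 4 * enorm (rdot M) u ^+ 2 <= enorm (rdot n) (u *m sign_mx G) ^+ 2) /\
    (forall i w, (i < m)%N -> w \in W i -> enorm (rdot M) w <= 1 ->
      enorm (rdot n) (w *m sign_mx G) ^+ 2 <= n%:R * A i).
Proof.
move=> small; apply: contrapT => bad.
pose T := {ffun 'I_n -> {ffun 'I_M -> bool}}.
pose low (u : 'rV[R]_M) (G : T) : R := if u == 0 then 0 else
  expR (16^-1 * (n%:R / 4 -
    enorm (rdot n) (((enorm (rdot M) u)^-1 *: u) *m sign_mx G) ^+ 2)).
pose up i (w : 'rV[R]_M) (G : T) : R := if enorm (rdot M) w <= 1 then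
  expR (16^-1 * (enorm (rdot n) (w *m sign_mx G) ^+ 2 - n%:R * A i)) else 0.
have low0 u G : 0 <= low u G by rewrite /low; case: ifP => // _; exact: expR_ge0.
have up0 i u G : 0 <= up i u G by rewrite /up; case: ifP => // _; exact: expR_ge0.
pose Phi G := \sum_(u <- S0) low u G + \sum_(i < m) \sum_(w <- W i) up i w G.
have Phi1 G : 1 <= Phi G.
  apply: contrapT => /negP; rewrite -ltNge => PhiG; apply: bad; exists G; split.
    move=> u uS; have [->|u0] := eqVneq u 0.
      by rewrite mul0mx !enorm0 expr0n mulr0.
    have nu : 0 < enorm (rdot M) u.
      rewrite lt_neqAle enorm_ge0 andbT eq_sym.
      by apply: contra_neq u0 => /enorm_eq0.
    have : low u G < expR 0.
      rewrite expR0; apply: le_lt_trans PhiG; rewrite /Phi (big_rem u uS)/= -addrA lerDl.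
      by rewrite addr_ge0// ?sumr_ge0// => i _; rewrite sumr_ge0.
    rewrite /low (negbTE u0) ltr_expR -scalemxAl enormZ.
    rewrite ger0_norm ?invr_ge0 ?enorm_ge0// exprMn exprVn => h.
    rewrite -ler_pdivlMr ?exprn_gt0// [leRHS]mulrC. lra.
  move=> i w im wW w1.
  have : up i w G < expR 0.
    rewrite expR0; apply: le_lt_trans PhiG; rewrite /Phi (bigD1 (Ordinal im))//= (big_rem w wW)/=.
    rewrite addrCA -addrA lerDl addr_ge0//.
      by rewrite ?sumr_ge0.
    by rewrite addr_ge0// sumr_ge0// => j _; rewrite sumr_ge0.
  by rewrite /up w1 ltr_expR => h; lra.
have NT : 0 < #|T|%:R :> R.
  by rewrite ltr0n; apply/card_gt0P; exists [ffun=> [ffun=> false]].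
have : #|T|%:R <= \sum_G Phi G.
  by rewrite -sumr_const; apply: ler_sum => G _; exact: Phi1.
apply/negP; rewrite -ltNge -[ltRHS]mulr1.
set B := (X in X < 1) in small; apply: (@le_lt_trans _ _ (#|T|%:R * B));
  last by rewrite ltr_pM2l.
rewrite /B /Phi big_split/= mulrDr lerD//.
  rewrite exchange_big/= mulrCA; apply: sum_seq_le => u uS; rewrite /low.
  have [_|u0] := eqVneq u 0; first by rewrite big1// mulr_ge0// expR_ge0.
  by apply: signs_lower_tail; exact: enorm_normalize.
rewrite exchange_big/= mulr_sumr; apply: ler_sum => i _.
rewrite exchange_big/= mulrCA; apply: sum_seq_le => w wW; rewrite /up.
have [w1|_] := boolP (_ <= 1); last by rewrite big1// mulr_ge0// expR_ge0.
exact: signs_upper_tail.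
Qed.

End RandomSubspace.

(** * Kolmogorov widths from entropy numbers *)

Section DualBall.
Context {R : realType} {M : nat} (q : 'rV[R]_M -> R).
Hypothesis sq : seminorm q.

Local Notation dot := (rdot M).
Local Notation nrm := (enorm (rdot M)).

Definition dual_ball : set 'rV[R]_M := [set h | forall u, dot h u <= q u].

(* Duality of entropy for a Hilbert space (Tomczak-Jaegermann): if [x, y] lie in
   the dual ball and [q (x - y) <= s] then [|x - y|^2 <= 2 s]. *)
Lemma covered_dual_ball (t : R) L1 L2 : 0 < t ->
  covered dual_ball (fun x y => nrm (x - y)) (2 * t) L1 ->
  covered (@unit_row R M) (fun x y => q (x - y)) (t / 8) L2 ->
  covered dual_ball (fun x y => nrm (x - y)) t (L1 + L2).
Proof.
move=> t0 [s1 ss1 hs1] [s2 ss2 hs2].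
pose good (y z x : 'rV[R]_M) := dual_ball x /\ q (x - y - (2 * t) *: z) <= t ^+ 2 / 4.
exists [seq xget 0 [set x | good y z x] | y <- s1, z <- s2].
  by rewrite size_allpairs expnD leq_mul.
move=> x Kx; have [y ys1 xy] := hs1 _ Kx.
have [|z zs xyz] := hs2 ((2 * t)^-1 *: (x - y)).
  rewrite /unit_row/= enormZ ger0_norm ?invr_ge0; last by lra.
  by rewrite ler_pdivrMl ?mulr1//; lra.
have gx : good y z x.
  split => //; have -> : x - y - (2 * t) *: z = (2 * t) *: ((2 * t)^-1 *: (x - y) - z).
    by rewrite scalerBr scalerA mulfV ?scale1r//; apply/eqP; lra.
  rewrite (seminormZ sq) ger0_norm; last by lra.
  by rewrite (le_trans (ler_wpM2l _ xyz))//; [lra|rewrite expr2; lra].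
exists (xget 0 [set x | good y z x]).
  by apply/allpairsP; exists (y, z).
have /(_ (ex_intro _ x gx)) := @xgetPex _ 0 [set x | good y z x].
set x0 := xget _ _ => -[/= Kx0 qx0].
have qd : q (x - x0) <= t ^+ 2 / 2.
  have -> : x - x0 = (x - y - (2 * t) *: z) - (x0 - y - (2 * t) *: z).
    by rewrite opprB addrA subrK opprB addrA subrK.
  by have := seminormB sq (x - y - (2 * t) *: z) (x0 - y - (2 * t) *: z); have := gx.2; lra.
rewrite -(@ler_pXn2r _ 2) ?nnegrE ?enorm_ge0 ?(ltW t0)// sqr_enorm dotBl.
have := Kx (x - x0); have := Kx0 (- (x - x0)).
rewrite (seminormN sq) -scaleN1r dotZr; lra.
Qed.

Lemma dual_ball_bounded (C h : _) : 0 <= C -> (forall x, q x <= C * nrm x) ->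
  dual_ball h -> nrm h <= C.
Proof.
move=> C0 qC Kh; have := enorm_ge0 (rdot M) h.
rewrite le_eqVlt => /predU1P[<- //|nh].
by rewrite -(ler_pM2r nh) -expr2 sqr_enorm (le_trans (Kh h)).
Qed.

(** Starting from the single ball of radius [C], the [j] halvings cost [Lam 1 + ... + Lam j] bits, a
    geometric sum dominated by its last term because [b > 1]. *)
Lemma covered_dual_ball_dyadic (C b : R) (Lam : nat -> nat) : 0 < C -> 1 < b ->
  (forall x, q x <= C * nrm x) ->
  (forall j, covered (@unit_row R M) (fun x y => q (x - y))
     (C * 2^-1 ^+ j / 8) (Lam j)) ->
  (forall j, (Lam j)%:R <= 64 * b ^+ j) ->
  forall j, exists2 L : nat, L%:R <= 64 * b / (b - 1) * b ^+ j &
    covered dual_ball (fun x y => nrm (x - y)) (C * 2^-1 ^+ j) L.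
Proof.
move=> C0 b1 qC covD LamB; elim=> [|j [L LB covK]].
  exists 0%N.
    by rewrite expr0 mulr1 divr_ge0//; lra.
  exists [:: 0] => // x Kx; exists 0; rewrite ?mem_head// subr0 expr0 mulr1.
  exact: dual_ball_bounded (ltW C0) qC Kx.
exists (L + Lam j.+1)%N; last first.
  apply: covered_dual_ball (covD _).
    by rewrite mulr_gt0// exprn_gt0// invr_gt0.
  have -> // : 2 * (C * 2^-1 ^+ j.+1) = C * 2^-1 ^+ j by rewrite exprS; field.
rewrite natrD (le_trans (lerD LB (LamB _)))// exprS.
have : 0 < b ^+ j by rewrite exprn_gt0//; lra.
have : 64 * b / (b - 1) * (b * b ^+ j) =
  64 * b / (b - 1) * b ^+ j + 64 * (b * b ^+ j).
  by field; apply/eqP; lra.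
lra.
Qed.

End DualBall.

(** * Chaining over nets of a set *)

Section Chaining.
Context {R : realType} {M : nat} (K : set 'rV[R]_M).

Local Notation nrm := (enorm (rdot M)).

Lemma exprn_ge_1Dn (b : R) i : 1 <= b -> 1 + i%:R * (b - 1) <= b ^+ i.
Proof.
move=> b1; elim: i => [|i IH]; first by rewrite expr0 mul0r addr0.
have i0 : 0 <= (i%:R : R) * (b - 1) by rewrite mulr_ge0//; lra.
rewrite exprS -natr1; apply: (@le_trans _ _ (b * (1 + i%:R * (b - 1)))).
  nra.
by rewrite ler_wpM2l//; lra.
Qed.

Lemma sum_geometric_le (x : R) m : 0 <= x -> x < 1 ->
  \sum_(i < m) x ^+ i <= (1 - x)^-1.
Proof.
move=> x0 x1; rewrite -[leRHS]mul1r ler_pdivlMr ?subr_gt0//.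
have -> : (\sum_(i < m) x ^+ i) * (1 - x) = 1 - x ^+ m.
  elim: m => [|m IH]; first by rewrite big_ord0 mul0r expr0 subrr.
  by rewrite big_ord_recr/= mulrDl IH exprS; ring.
by rewrite lerBlDr lerDl exprn_ge0.
Qed.

Lemma expr2_le_expR L : (2 ^ L)%:R <= expR (L%:R : R).
Proof.
rewrite natrX -[X in expR X]mulr1 expRM_natl lerXn2r ?nnegrE ?expR_ge0//.
by have := expR_ge1Dx (1 : R); lra.
Qed.

(** The union bound. At level [i] the squared length [16 n b^i] is allowed, with failure exponent
    [n (1/8 - b^i)]; by the lower bound on [n] the number of increments costs at most [n b^i / 64]
    in the exponent. Level [i] thus fails with weight at most [2^-(i+2)], all levels together at
    most 1/2, and the coarsest net at most 1/4. *)
Lemma chaining_failure_lt1 (b B : R) (n m j0 : nat) (s0 : nat) (s : nat -> nat) :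
  1 < b -> 64 * b / (b - 1) <= B -> 128 * B * b ^+ j0.+1 <= n%:R ->
  s0%:R <= expR (B * b ^+ j0) ->
  (forall i, (s i)%:R <= expR (2 * B * b ^+ (j0 + i).+1)) ->
  s0%:R * expR (- (n%:R / 64)) +
    \sum_(i < m) (s i)%:R * expR (n%:R * (8^-1 - 16 * b ^+ i / 16)) < 1 :> R.
Proof.
move=> b1 BB nB hs0 hs.
have B64 : 64 <= B by apply: le_trans BB; rewrite ler_pdivlMr; lra.
have bj : 1 <= b ^+ j0 by rewrite exprn_ege1// ltW.
have nB' : 128 * B * b * b ^+ j0 <= n%:R by move: nB; rewrite exprS mulrA.
have n1 : 128 * (B * b ^+ j0) <= n%:R.
  apply: le_trans nB'; have : 0 <= B * b ^+ j0 by nra.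
  by nra.
have Bj : 64 <= B * b ^+ j0 by nra.
have t1 : s0%:R * expR (- (n%:R / 64)) <= 4^-1 :> R.
  rewrite (le_trans (ler_wpM2r (expR_ge0 _) hs0))// -expRD.
  apply: (@le_trans _ _ (expR (- 64))); first by rewrite ler_expR; lra.
  rewrite expRN lef_pV2 ?posrE ?expR_gt0//.
  by have := expR_ge1Dx (64 : R); lra.
have t2 : \sum_(i < m) (s i)%:R * expR (n%:R * (8^-1 - 16 * b ^+ i / 16)) <= 2^-1 :> R.
  apply: (@le_trans _ _ (\sum_(i < m) 4^-1 * (2^-1 : R) ^+ i)); last first.
    by rewrite -mulr_sumr; have := sum_half_pow (R := R) m; lra.
  apply: ler_sum => i _.
  rewrite (le_trans (ler_wpM2r (expR_ge0 _) (hs i)))// -expRD.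
  have bi : 1 + i%:R * (b - 1) <= b ^+ i by apply: exprn_ge_1Dn; lra.
  have bi1 : 1 <= b ^+ i by rewrite exprn_ege1// ltW.
  have e1 : 2 * B * b ^+ (j0 + i).+1 <= n%:R * b ^+ i / 64.
    rewrite exprS exprD.
    have := ler_wpM2r (ltW (lt_le_trans ltr01 bi1)) nB'; lra.
  have e2 : i%:R + 2 <= n%:R * b ^+ i / 2.
    have h : 64 * b <= B * (b - 1) by rewrite -ler_pdivrMr//; lra.
    have n2 : 128 * B * b <= n%:R.
      by apply: le_trans nB'; rewrite ler_peMr//; nra.
    have h2 : 128 * B * (1 + i%:R * (b - 1)) <= n%:R * b ^+ i.
      have i0 : 0 <= (i%:R : R) * (b - 1) by rewrite mulr_ge0//; lra.
      apply: ler_pM => //; [lra|lra|].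
      by apply: le_trans n2; nra.
    have i0 : 0 <= (i%:R : R) by [].
    have h3 : i%:R * (64 * b) <= i%:R * (B * (b - 1)) by rewrite ler_wpM2l.
    have h4 : i%:R * 64 <= i%:R * (64 * b) by rewrite ler_wpM2l//; lra.
    nra.
  apply: (@le_trans _ _ (expR (- (i%:R + 2)))).
    have e3 : n%:R <= n%:R * b ^+ i by rewrite ler_peMr.
    rewrite ler_expR mulrBr; lra.
  have -> : 4^-1 * (2^-1 : R) ^+ i = ((2 ^ (i + 2))%:R)^-1.
    by rewrite natrX exprD exprVn invfM mulrC; congr (_ * _); lra.
  rewrite expRN lef_pV2 ?posrE ?expR_gt0 ?ltr0n ?expn_gt0//.
  by rewrite -(natrD _ i 2) expr2_le_expR.
lra.
Qed.

(* Chaining along nets at the scales [C 2^-j]: the images of the increments have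
   norms of order [2^-i sqrt b ^ i], which are summable because [b < 4]; with
   [b = 2 ^ alpha] this is where [alpha < 2] is needed. *)
Lemma random_kernel_radius (C b B : R) (n j0 : nat) :
  0 < C -> 1 < b -> b < 4 -> 64 * b / (b - 1) <= B ->
  128 * B * b ^+ j0.+1 <= n%:R ->
  (forall j, exists2 L : nat, L%:R <= B * b ^+ j &
    covered K (fun x y => nrm (x - y)) (C * 2^-1 ^+ j) L) ->
  exists G : 'M[R]_(M, n), forall h, K h -> h *m G = 0 ->
    nrm h <= C * 2^-1 ^+ j0 * (3 + 16 / (1 - Num.sqrt b / 2)).
Proof.
move=> C0 b1 b4 BB nB covK.
pose t j : R := C * 2^-1 ^+ j.
have t0 j : 0 < t j by rewrite mulr_gt0// exprn_gt0.
have tS j : t j.+1 = t j / 2 by rewrite /t exprS; ring.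
have tD j i : t (j + i)%N = t j * 2^-1 ^+ i by rewrite /t exprD mulrA.
have /choice[S hS] : forall j, exists s : seq 'rV[R]_M,
    (size s)%:R <= expR (B * b ^+ j) /\
    forall x, K x -> exists2 y, y \in s & nrm (x - y) <= t j.
  move=> j.
  have [L LB [s ss hs]] := covK j; exists s; split => //.
  apply: (@le_trans _ _ (2 ^ L)%:R); first by rewrite ler_nat.
  by rewrite (le_trans (expr2_le_expR L))// ler_expR.
pose W i := [seq (2 * t (j0 + i)%N)^-1 *: (y - z) | y <- S (j0 + i).+1, z <- S (j0 + i)%N].
have B0 : 0 <= B by apply: le_trans BB; rewrite divr_ge0//; lra.
have sW i : (size (W i))%:R <= expR (2 * B * b ^+ (j0 + i).+1).
  rewrite size_allpairs natrM (le_trans (ler_pM _ _ (hS _).1 (hS _).1))//.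
  rewrite -expRD ler_expR exprS; have : 0 < b ^+ (j0 + i) by rewrite exprn_gt0//; lra.
  move: (b ^+ _) => x x0; have : 0 <= B * x * (b - 1) by rewrite mulr_ge0 ?mulr_ge0//; lra.
  lra.
have small := chaining_failure_lt1 M b1 BB nB (hS j0).1 sW.
have [G [lowG upG]] := signs_exist (A := fun i => 16 * b ^+ i) small.
exists (sign_mx G) => h Kh hG.
have /choice[y hy] : forall i, exists y, y \in S (j0 + i)%N /\ nrm (h - y) <= t (j0 + i)%N.
  move=> i.
  by have [y] := (hS (j0 + i)%N).2 _ Kh; exists y.
pose sn : R := Num.sqrt n%:R; have sn2 : sn ^+ 2 = n%:R by rewrite sqr_sqrtr.
have n0 : 0 < (n%:R : R).
  apply: lt_le_trans nB; rewrite mulr_gt0 ?exprn_gt0//; last by lra.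
  by rewrite mulr_gt0//; apply: lt_le_trans BB; rewrite divr_gt0//; lra.
have sn0 : 0 < sn by rewrite sqrtr_gt0.
pose be := Num.sqrt b / 2.
have sb2 : Num.sqrt b ^+ 2 = b by rewrite sqr_sqrtr//; lra.
have sb0 : 0 <= Num.sqrt b := sqrtr_ge0 b.
have be0 : 0 <= be by rewrite divr_ge0.
have be1 : be < 1 by rewrite /be; nra.
pose gn : 'rV[R]_n -> R := enorm (rdot n).
have gn0 v : 0 <= gn v by exact: enorm_ge0.
have step i : (i < M)%N -> gn ((y i.+1 - y i) *m sign_mx G) <= sn * (8 * t j0 * be ^+ i).
  move=> iM.
  have ti0 := t0 (j0 + i)%N.
  pose w := (2 * t (j0 + i)%N)^-1 *: (y i.+1 - y i).
  have w1 : nrm w <= 1.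
    rewrite enormZ ger0_norm ?invr_ge0; last by lra.
    rewrite ler_pdivrMl ?mulr1; last by lra.
    have -> : y i.+1 - y i = (h - y i) - (h - y i.+1) by rewrite opprB [RHS]addrC addrA subrK.
    rewrite (le_trans (enormD _ _ _))// enormN.
    have := (hy i).2; have := (hy i.+1).2; rewrite addnS tS; lra.
  have wW : w \in W i.
    apply/allpairsP; exists (y i.+1, y i) => /=; split => //; last exact: (hy i).1.
    by rewrite -addnS; exact: (hy i.+1).1.
  have := upG i w iM wW w1; rewrite -/gn => up.
  have -> : y i.+1 - y i = (2 * t (j0 + i)%N) *: w.
    by rewrite scalerA mulfV ?scale1r//; apply/eqP; lra.
  rewrite -scalemxAl /gn enormZ -/gn ger0_norm; last by lra.
  have up' : gn (w *m sign_mx G) <= sn * (4 * Num.sqrt b ^+ i).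
    rewrite -(@ler_pXn2r _ 2) ?nnegrE ?gn0 ?mulr_ge0 ?exprn_ge0 ?(ltW sn0)//.
    by rewrite exprMn sn2 exprMn -exprM mulnC exprM sb2 (le_trans up)// -natrX.
  have -> : sn * (8 * t j0 * be ^+ i) = 2 * t (j0 + i)%N * (sn * (4 * Num.sqrt b ^+ i)).
    by rewrite tD /be exprMn; ring.
  by rewrite ler_wpM2l//; lra.
(* The chain has [M] links for this estimate: at the scale [t j0 * 2^-M] the loss [M] of
   [sign_mx_bound] is harmless because [M <= 4^M], and [M] disappears from the result. *)
have tail : gn ((h - y M) *m sign_mx G) <= sn * t j0.
  rewrite -(@ler_pXn2r _ 2) ?nnegrE ?gn0 ?mulr_ge0 ?(ltW sn0) ?(ltW C0)//.
  rewrite (le_trans (sign_mx_bound _ _))// exprMn sn2 natrM -mulrA ler_wpM2l//.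
  have hM := (hy M).2; rewrite tD in hM.
  apply: (@le_trans _ _ (M%:R * (t j0 * 2^-1 ^+ M) ^+ 2)).
    by rewrite ler_wpM2l// lerXn2r ?nnegrE ?enorm_ge0// mulr_ge0 ?exprn_ge0 ?(ltW (t0 _)).
  rewrite exprMn mulrCA ler_piMr ?sqr_ge0//.
  have hM2 : M%:R <= 2 ^+ M :> R by rewrite -natrX ler_nat ltnW// ltn_expl.
  have hM1 : 1 <= 2 ^+ M :> R by rewrite exprn_ege1// ler1n.
  rewrite exprVn exprVn ler_pdivrMr ?exprn_gt0// mul1r.
  by move: hM2 hM1; move: (2 ^+ M) => z z1 z2; nra.
(* Since [h] is annihilated, the image of its coarsest approximation comes only from the increments
   and the tail. The lower bound [lowG] on the net [S j0] then turns this into a bound on [y 0]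
   itself. *)
have y0 : gn (y 0%N *m sign_mx G) <= sn * (t j0 * (1 + 8 / (1 - be))).
  have -> : y 0%N = h - (h - y M) - \sum_(i < M) (y i.+1 - y i).
    rewrite -(big_mkord xpredT (fun i => y i.+1 - y i)) telescope_sumr//.
    by rewrite !subKr.
  rewrite mulmxBl (mulmxBl h) hG sub0r mulmx_suml.
  rewrite (le_trans (enormD _ _ _))// !enormN.
  rewrite mulrDr mulr1 mulrDr; apply: lerD; first exact: tail.
  apply: le_trans (enorm_sum _ _ _ _) _.
  apply: (@le_trans _ _ (\sum_(i < M) sn * (8 * t j0 * be ^+ i))).
    by apply: ler_sum => i _; exact: step.
  rewrite -!mulr_sumr ler_wpM2l ?(ltW sn0)//.
  have -> : t j0 * (8 / (1 - be)) = 8 * t j0 * (1 - be)^-1 by ring.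
  by rewrite ler_wpM2l ?sum_geometric_le// mulr_ge0 ?(ltW (t0 _)).
have ny0 : nrm (y 0%N) <= 2 * (t j0 * (1 + 8 / (1 - be))).
  have := lowG (y 0%N); rewrite -{1}(addn0 j0) => /(_ (hy 0%N).1) low.
  have hq : sn / 2 * nrm (y 0%N) <= gn (y 0%N *m sign_mx G).
    rewrite -(@ler_pXn2r _ 2) ?nnegrE ?gn0 ?mulr_ge0 ?divr_ge0 ?enorm_ge0 ?(ltW sn0)//.
    by move: low; rewrite !exprMn sn2 exprVn -natrX.
  rewrite -(ler_pM2l (_ : 0 < sn / 2)) ?divr_gt0//.
  have e (z : R) : sn / 2 * (2 * z) = sn * z by field.
  by rewrite e (le_trans hq).
have := (hy 0%N).2; rewrite addn0 => h0.
have -> : h = (h - y 0%N) + y 0%N by rewrite subrK.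
rewrite (le_trans (enormD _ _ _))// -/(t j0) -/be.
have -> : t j0 * (3 + 16 / (1 - be)) = t j0 + 2 * (t j0 * (1 + 8 / (1 - be))) by ring.
exact: lerD.
Qed.

End Chaining.

Section KolmogorovFromEntropy.
Context {R : realType}.

Lemma seminorm_inf_sublinear (V W : lmodType R) (q : V -> R) (f : W -> V) :
  seminorm q -> (forall (a : R) u v, f (a *: u + v) = a *: f u + f v) ->
  sublinear (fun x => inf [set q (x - f c) | c in [set: W]]).
Proof.
move=> sq lf; pose S x := [set q (x - f c) | c in [set: W]].
have fD u v : f (u + v) = f u + f v by rewrite -[u in LHS]scale1r lf scale1r.
have f0 : f 0 = 0 by have := fD 0 0; rewrite addr0 => /eqP; rewrite -subr_eq subrr => /eqP.
have fZ a u : f (a *: u) = a *: f u by rewrite -[a *: u]addr0 lf f0 addr0.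
have Slb x : has_lbound (S x).
  by exists 0 => _ [c _ <-]; exact: seminorm_ge0.
have Sle x c : inf (S x) <= q (x - f c) by apply: ge_inf => //; exists c.
have Sge x y : (forall c, y <= q (x - f c)) -> y <= inf (S x).
  move=> h; apply: lb_le_inf; last by move=> _ [c _ <-].
  by exists (q (x - f 0)); exists 0.
have SZ (a : R) x : 0 < a -> inf (S (a *: x)) <= a * inf (S x).
  move=> a0; rewrite -ler_pdivrMl//; apply: (Sge) => c; rewrite ler_pdivrMl//.
  rewrite -[a in leRHS]gtr0_norm// -seminormZ// scalerBr -fZ; exact: Sle.
split=> [x y|a x a0].
  rewrite -lerBlDr; apply: (Sge) => c; rewrite lerBlDr -lerBlDl.
  apply: (Sge) => c'; rewrite lerBlDl (le_trans (Sle _ (c + c')))//.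
  by rewrite fD opprD addrACA; exact: seminormD.
apply/eqP; rewrite eq_le SZ//=.
have /SZ : 0 < a^-1 by rewrite invr_gt0.
move=> /(_ (a *: x)); rewrite scalerA mulVf ?gt_eqF// scale1r.
by rewrite ler_pdivlMl.
Qed.

(* Hahn-Banach: the distance to the span of the columns of [G] is attained by a
   functional of the dual ball that vanishes on these columns. *)
Lemma dist_le_of_kernel M n (q : 'rV[R]_M -> R) (G : 'M[R]_(M, n)) (r r' : R) x :
  seminorm q ->
  (forall h, dual_ball q h -> h *m G = 0 -> enorm (rdot M) h <= r) ->
  enorm (rdot M) x <= 1 -> r < r' -> exists c : 'rV[R]_n, q (x - c *m G^T) < r'.
Proof.
move=> sq hr x1 rr'.
pose f (c : 'rV[R]_n) := c *m G^T.
have lf (a : R) u v : f (a *: u + v) = a *: f u + f v.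
  by rewrite /f mulmxDl scalemxAl.
have [h [hp hx]] := hahn_banach_row x (seminorm_inf_sublinear sq lf).
have inf_le y c : inf [set q (y - f c) | c in [set: 'rV[R]_n]] <= q (y - f c).
  apply: ge_inf; last by exists c.
  by exists 0 => _ [c' _ <-]; exact: seminorm_ge0.
have Kh : dual_ball q h.
  move=> u; rewrite (le_trans (hp u))// (le_trans (inf_le u 0))//.
  by rewrite /f mul0mx subr0.
have hG : h *m G = 0.
  apply/rowP => i; rewrite mxE mxE.
  have colle (a : R) : a * \sum_j h 0 j * G j i <= 0.
    have -> : a * (\sum_j h 0 j * G j i) = rdot M h (f (a *: delta_mx 0 i)).
      rewrite /f -scalemxAl -rowE dotZr; congr (_ * _).
      by rewrite rdotE; apply: eq_bigr => j _; rewrite !mxE.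
    rewrite (le_trans (hp _))// (le_trans (inf_le _ (a *: delta_mx 0 i)))//.
    by rewrite subrr (seminorm0 sq).
  apply/eqP; rewrite eq_le; have := colle 1; have := colle (- 1).
  by rewrite mul1r mulN1r oppr_le0 => -> ->.
have hx' : inf [set q (x - f c) | c in [set: 'rV[R]_n]] < r'.
  rewrite -hx (le_lt_trans (cauchy_schwarz _ _ _))//.
  apply: le_lt_trans rr'; rewrite -[leRHS]mulr1.
  by apply: ler_pM => //; [exact: enorm_ge0|exact: enorm_ge0|exact: hr].
have [|_ [c _ <-] qc] := inf_lt _ hx'; first by exists (q (x - f 0)); exists 0.
by exists c.
Qed.

Lemma geometric_bracket (x b y : R) : 0 < x -> 1 < b -> x <= y ->
  exists j : nat, x * b ^+ j <= y /\ y < x * b ^+ j.+1.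
Proof.
move=> x0 b1 xy.
have [N hN] : exists N : nat, y < x * b ^+ N.
  have [N hN] : exists N : nat, y / x / (b - 1) <= N%:R.
    by exists (Num.truncn (y / x / (b - 1))).+1; rewrite ltW// truncnS_gt.
  exists N; rewrite -ltr_pdivrMl// mulrC.
  apply: lt_le_trans (exprn_ge_1Dn N (ltW b1)).
  by move: hN; rewrite ler_pdivrMr ?subr_gt0//; lra.
elim: N hN => [|N IH] hN; first by move: hN; rewrite expr0 mulr1; lra.
have [/IH //|h] := ltP y (x * b ^+ N).
by exists N.
Qed.

Lemma ltr_powR (a x y : R) : 1 < a -> x < y -> a `^ x < a `^ y.
Proof.
move=> a1 xy; have a0 : 0 < a by exact: lt_trans a1.
by rewrite /powR gt_eqF// ltr_expR ltr_pM2r// ln_gt0.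
Qed.

Lemma powRV (x r : R) : 0 <= x -> x^-1 `^ r = (x `^ r)^-1.
Proof. by move=> x0; rewrite -powR_inv1// -powRrM mulN1r powRN. Qed.

Lemma two_powR_bounds (alpha : R) : 0 < alpha -> alpha < 2 ->
  1 < 2 `^ alpha /\ 2 `^ alpha < 4.
Proof.
move=> a0 a2; split.
  by rewrite -[ltLHS](powRr0 2) ltr_powR// ltr1n.
have -> : 4 = 2 `^ 2%:R :> R by rewrite powR_mulrn//; ring.
by rewrite ltr_powR// ltr1n.
Qed.

Lemma powR_two_expr (alpha : R) j : (2 `^ alpha) ^+ j = (2 ^+ j) `^ alpha.
Proof.
elim: j => [|j IH]; first by rewrite !expr0 powR1.
by rewrite !exprS IH powRM// exprn_ge0.
Qed.

Lemma powR_invK (x alpha : R) : 0 <= x -> alpha != 0 -> (x `^ alpha) `^ alpha^-1 = x.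
Proof. by move=> x0 a0; rewrite -powRrM mulfV// powRr1. Qed.

(** With [L = 0] there is a single centre; [x] and [- x] are both within [C] of it, so
    [q (2 x) <= 2 C]. *)
Lemma seminorm_le_of_covered M (q : 'rV[R]_M -> R) (C : R) : seminorm q -> 0 <= C ->
  covered (@unit_row R M) (fun x y => q (x - y)) C 0 ->
  forall x, q x <= C * enorm (rdot M) x.
Proof.
move=> sq C0 [s ss hs].
have small x : unit_row x -> q x <= C.
  move=> x1; have [y ys xy] := hs _ x1.
  have [|z zs xz] := hs (- x); first by rewrite /unit_row/= enormN.
  have zy : z = y.
    move: ss zs ys; case: s {hs} => [|a [|? ?]]//= _.
    by rewrite !inE => /eqP-> /eqP->.
  have : q (2 *: x) <= C + C.
    have -> : 2 *: x = (x - y) - (- x - z) by rewrite zy opprB opprK addrA subrK scaler_nat mulr2n.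
    by rewrite (le_trans (seminormB sq _ _))// lerD.
  rewrite (seminormZ sq) ger0_norm//; lra.
move=> x; have [->|x0] := eqVneq x 0; first by rewrite (seminorm0 sq) mulr_ge0 ?enorm_ge0.
have nx : 0 < enorm (rdot M) x.
  by rewrite lt_neqAle enorm_ge0 andbT eq_sym; apply: contra_neq x0 => /enorm_eq0.
have /small : unit_row ((enorm (rdot M) x)^-1 *: x).
  by rewrite /unit_row/= enorm_normalize.
by rewrite (seminormZ sq) ger0_norm ?invr_ge0 ?(ltW nx)// ler_pdivrMl// mulrC.
Qed.

(** With [b = 2 ^ alpha], radius [C 2^-j / 8] takes at most [(8 * 2^j)^alpha <= 64 b^j] bits.
    Bracketing [n] between [N0 b^j0] and [N0 b^(j0+1)] makes [C 2^-j0] of order [n^(-1/alpha)]. [C']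
    is chosen before [M]. *)
Lemma kolmogorov_of_entropy (alpha C : R) : 0 < alpha -> alpha < 2 -> 0 < C ->
  exists2 C' : R, 0 < C' & forall M (q : 'rV[R]_M -> R), seminorm q ->
    (forall k, (0 < k)%N -> covered (@unit_row R M) (fun x y => q (x - y))
      (C * k%:R `^ (- alpha^-1)) k.-1) ->
    forall n, (0 < n)%N -> exists g : 'I_n -> 'rV[R]_M, forall x,
      enorm (rdot M) x <= 1 -> exists c : 'I_n -> R,
      q (x - \sum_(i < n) c i *: g i) <= C' * n%:R `^ (- alpha^-1).
Proof.
move=> a0 a2 C0; have [b1 b4] := two_powR_bounds a0 a2.
set b := 2 `^ alpha in b1 b4.
have an0 : alpha != 0 by rewrite gt_eqF.
pose B := 64 * b / (b - 1).
have B0 : 0 < B by rewrite divr_gt0//; lra.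
pose N0 := 128 * B * b.
have N00 : 0 < N0 by rewrite mulr_gt0//; lra.
pose D := 3 + 16 / (1 - Num.sqrt b / 2).
have D0 : 0 < D.
  have sb2 : Num.sqrt b ^+ 2 = b by rewrite sqr_sqrtr//; lra.
  have sb0 : 0 <= Num.sqrt b := sqrtr_ge0 b.
  by rewrite addr_gt0// divr_gt0//; nra.
pose K0 := N0 `^ alpha^-1.
have K00 : 0 < K0 by rewrite powR_gt0.
(* The first summand serves [n < N0], where the zero subspace is used. The second dominates the
   kernel radius with room for the strict inequality that [dist_le_of_kernel] requires. *)
pose C' := C * K0 + 2 * (C * 2 * K0 * D).
have CD0 : 0 < C * 2 * K0 * D by rewrite !mulr_gt0.
exists C'; first by rewrite addr_gt0 ?mulr_gt0.
move=> M q sq covD n n0.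
have np : 0 < n%:R `^ (- alpha^-1) :> R by rewrite powR_gt0// ltr0n.
have K0n : K0 * n%:R `^ (- alpha^-1) = (N0 / n%:R) `^ alpha^-1.
  by rewrite powRN [RHS]powRM ?(ltW N00) ?invr_ge0// powRV.
have qC : forall x, q x <= C * enorm (rdot M) x.
  apply: seminorm_le_of_covered => //; first exact: ltW.
  by have := covD 1%N isT; rewrite powR1 mulr1.
have [nN0|N0n] := ltP n%:R N0.
  exists (fun=> 0) => x x1; exists (fun=> 0); rewrite big1 ?subr0; last first.
    by move=> *; rewrite scale0r.
  rewrite (le_trans (qC x))//.
  apply: (@le_trans _ _ (C * (K0 * n%:R `^ (- alpha^-1)))).
    rewrite ler_wpM2l ?(ltW C0)// (le_trans x1)// K0n.
    apply: (@le_trans _ _ (1 `^ alpha^-1)); first by rewrite powR1.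
    rewrite ge0_ler_powR ?nnegrE ?invr_ge0 ?(ltW a0)//.
      by rewrite divr_ge0 ?(ltW N00).
    by rewrite ler_pdivlMr ?ltr0n// mul1r ltW.
  by rewrite mulrA ler_wpM2r ?(ltW np)// lerDl mulr_ge0 ?(ltW CD0).
(* The index [k = lam j + 1] exceeds [(8 * 2^j)^alpha], so its radius is at most [C 2^-j / 8], while
   its cover uses only [k - 1 = lam j] bits. *)
pose lam j : nat := Num.truncn ((8 * 2 ^+ j) `^ alpha : R).
have lamP j : (lam j)%:R <= (8 * 2 ^+ j) `^ alpha :> R by rewrite truncn_le// powR_ge0.
have lamB j : (lam j)%:R <= 64 * b ^+ j.
  rewrite (le_trans (lamP j))// powRM ?exprn_ge0// -powR_two_expr.
  rewrite ler_wpM2r ?exprn_ge0 ?powR_ge0//.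
  have -> : 64 = 8 `^ 2%:R :> R by rewrite powR_mulrn//; ring.
  by rewrite ler_powR ?ler1n// ltW.
have covlam j : covered (@unit_row R M) (fun x y => q (x - y)) (C * 2^-1 ^+ j / 8) (lam j).
  have [s ss hs] := covD (lam j).+1 isT.
  exists s => // x /hs[y ys xy]; exists y => //.
  rewrite (le_trans xy)// -mulrA ler_wpM2l ?(ltW C0)//.
  have -> : 2^-1 ^+ j / 8 = (8 * 2 ^+ j : R)^-1 by rewrite invfM exprVn mulrC.
  rewrite powRN lef_pV2 ?posrE ?powR_gt0 ?ltr0n ?mulr_gt0 ?exprn_gt0//.
  rewrite -[leLHS](powR_invK _ an0) ?mulr_ge0 ?exprn_ge0//.
  rewrite ge0_ler_powR ?nnegrE ?invr_ge0 ?powR_ge0 ?(ltW a0)//.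
  by rewrite ltW// truncnS_gt.
have [j0 [j0n nj0]] := geometric_bracket N00 b1 N0n.
have nB : 128 * B * b ^+ j0.+1 <= n%:R by rewrite exprS mulrA.
have [G hG] := random_kernel_radius C0 b1 b4 (lexx B) nB
  (covered_dual_ball_dyadic sq C0 b1 qC covlam lamB).
have rad : C * 2^-1 ^+ j0 * D <= C * 2 * K0 * D * n%:R `^ (- alpha^-1).
  rewrite [leRHS]mulrAC ler_wpM2r ?(ltW D0)// -!mulrA ler_wpM2l ?(ltW C0)//.
  rewrite K0n.
  have -> : 2^-1 ^+ j0 = 2 * ((b ^+ j0.+1)^-1) `^ alpha^-1 :> R.
    rewrite powRV ?exprn_ge0 ?powR_ge0// powR_two_expr.
    by rewrite powR_invK ?exprn_ge0// exprS exprVn invfM mulrA divff ?mul1r.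
  rewrite ler_wpM2l// ge0_ler_powR ?nnegrE ?invr_ge0 ?exprn_ge0 ?powR_ge0 ?(ltW a0)//.
    by rewrite divr_ge0 ?(ltW N00).
  rewrite ler_pdivlMr ?ltr0n// ler_pdivrMl ?exprn_gt0 ?powR_gt0//.
  by rewrite mulrC ltW.
exists (fun i => row i G^T) => x x1.
have lt_rad : C * 2^-1 ^+ j0 * D < C' * n%:R `^ (- alpha^-1).
  apply: le_lt_trans rad _; rewrite ltr_pM2r// /C'.
  by have : 0 < C * K0 by [rewrite mulr_gt0]; lra.
have [c qc] := dist_le_of_kernel sq hG x1 lt_rad.
by exists (fun i => c 0 i); rewrite -mulmx_sum_row ltW.
Qed.

End KolmogorovFromEntropy.

(** * Entropy numbers from widths *)

Section Carl.
Context {R : realType} {V : lmodType R} (b : {dot V for idfun}).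
Implicit Types (U E : seq V) (q : V -> R).

Definition comb E (c : 'rV[R]_(size E)) : V := \sum_(k < size E) c 0 k *: E`_k.

Lemma comb_linear E (a : R) (c c' : 'rV[R]_(size E)) :
  comb (a *: c + c') = a *: comb c + comb c'.
Proof.
rewrite /comb scaler_sumr -big_split/=; apply: eq_bigr => k _.
by rewrite !mxE scalerDl scalerA.
Qed.

Lemma combB E (c c' : 'rV[R]_(size E)) : comb (c - c') = comb c - comb c'.
Proof. by rewrite /comb -sumrB; apply: eq_bigr => k _; rewrite !mxE scalerBl. Qed.

Lemma dot_comb E (c c' : 'rV[R]_(size E)) : orthonormal b E ->
  b (comb c) (comb c') = rdot (size E) c c'.
Proof.
move=> oE; rewrite rdotE /comb linear_sumlz; apply: eq_bigr => k _ /=.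
rewrite dotZl; congr (_ * _).
rewrite linear_sumr (bigD1 k)//= dotZr orthonormal_nth// eqxx mulr1.
rewrite big1 ?addr0// => j jk; rewrite dotZr orthonormal_nth//.
by rewrite eq_sym (negbTE (jk : (j != k :> nat))) mulr0.
Qed.

Lemma enorm_comb E (c : 'rV[R]_(size E)) : orthonormal b E ->
  enorm b (comb c) = enorm (rdot (size E)) c.
Proof. by move=> oE; rewrite /enorm dot_comb. Qed.

Lemma oproj_comb E x : oproj b E x = comb (\row_(k < size E) b x E`_k).
Proof.
by rewrite /oproj /comb (big_nth 0) big_mkord; apply: eq_bigr => k _; rewrite mxE.
Qed.

Lemma perp_comb E U (c : 'rV[R]_(size E)) : orthonormal b (E ++ U) ->
  perp b U (comb c).
Proof.
move=> oEU u uU; rewrite linear_sumlz big1// => k _ /=.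
by rewrite dotZl (orthonormal_cat_perp oEU)// ?mulr0// mem_nth.
Qed.

Lemma proj_net E U m i : orthonormal b (E ++ U) -> (size E <= m)%N ->
  exists2 s : seq V, (size s <= 2 ^ (6 * m * i))%N & forall x, enorm b x <= 1 ->
    exists2 y, y \in s &
      enorm b (oproj b E x - y) <= 2^-1 ^+ i /\ perp b U (oproj b E x - y).
Proof.
move=> oEU sE; have oE := orthonormal_catl oEU.
have [s ss hs] := covered_unit_row (R := R) (size E) i.
exists [seq comb c | c <- s].
  by rewrite size_map (leq_trans ss)// leq_exp2l// !leq_mul.
move=> x x1; have [|c cs xc] := hs (\row_k b x E`_k).
  by rewrite /unit_row/= -enorm_comb// -oproj_comb (le_trans (enorm_proj_le _ _)).
exists (comb c); first exact: map_f.
rewrite oproj_comb -combB enorm_comb//; split => //; exact: perp_comb.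
Qed.

Definition perp_ball U : set V := [set x | enorm b x <= 1 /\ perp b U x].

Lemma perp_cat E U x : perp b E x -> perp b U x -> perp b (E ++ U) x.
Proof. by move=> Ex Ux u; rewrite mem_cat => /orP[/Ex|/Ux]. Qed.

(** One level of Carl's argument. A vector orthogonal to [U] splits into its part along [E] and a
    part orthogonal to [E ++ U]. The net for the first part leaves an error of norm at most [2^-i]
    that is still orthogonal to [U], so the bound [w] applies to it after rescaling. *)
Lemma covered_peel q U E m i (w r : R) L : seminorm q -> orthonormal b (E ++ U) ->
  (size E <= m)%N -> 0 <= w -> (forall x, perp_ball U x -> q x <= w) ->
  covered (perp_ball (E ++ U)) (fun x y => q (x - y)) r L ->
  covered (perp_ball U) (fun x y => q (x - y)) (2^-1 ^+ i * w + r) (6 * m * i + L).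
Proof.
move=> sq oEU sE w0 qw [s' ss' hs'].
have oE := orthonormal_catl oEU.
have [s ss hs] := proj_net i oEU sE.
exists [seq y + z | y <- s, z <- s'].
  by rewrite size_allpairs expnD leq_mul.
move=> x [x1 Ux]; have [y ys [yx Uy]] := hs _ x1.
have [|z zs' xz] := hs' (x - oproj b E x).
  split; first exact: le_trans (enorm_subproj_le x oE) x1.
  apply: perp_cat; first exact: perp_subproj.
  move=> u uU; rewrite dotBl Ux// oproj_comb (perp_comb _ oEU)//; ring.
exists (y + z); first by apply/allpairsP; exists (y, z).
have -> : x - (y + z) = (oproj b E x - y) + (x - oproj b E x - z).
  by rewrite addrACA (addrC (oproj b E x)) subrK opprD addrC addrC.
rewrite (le_trans (seminormD sq _ _))// lerD//.
have p2 : 0 < (2 : R) ^+ i by rewrite exprn_gt0.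
rewrite exprVn mulrC ler_pdivlMr// mulrC -[_ ^+ i]gtr0_norm// -seminormZ//.
apply: qw; split; last by move=> u uU; rewrite dotZl Uy// mulr0.
by rewrite enormZ gtr0_norm// -ler_pdivlMl// mulr1 -exprVn.
Qed.

Lemma covered_le (T : choiceType) (A : set T) dist (r r' : R) L L' : r <= r' ->
  (L <= L')%N -> covered A dist r L -> covered A dist r' L'.
Proof.
move=> rr' LL' [s ss hs]; exists s; first by rewrite (leq_trans ss)// leq_exp2l.
by move=> x /hs[y ys xy]; exists y => //; exact: le_trans rr'.
Qed.

(** The second term is the remainder that makes the sum telescope to a value independent of [l]. *)
Lemma sum_level_sizes (J a c l : nat) : (l <= J.+1)%N ->
  (\sum_(i < l) 2 ^ (J - i) * (a + c * i) + 2 ^ (J.+1 - l) * (a + c * l.+1) =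
  2 ^ J.+1 * (a + c))%N.
Proof.
elim: l => [|l IH] lJ; first by rewrite big_ord0 subn0 muln1.
rewrite -(IH (ltnW lJ)) big_ord_recr/= subSS (subSn (lJ : (l <= J)%N)) expnS; nia.
Qed.

(* Carl's argument: the component of level [J - l] is approximated up to
   [2^-(a + c l)], so that both the errors and the numbers of bits decay
   geometrically in [l]. *)
Lemma carl_covering q (C th del : R) (J n a c : nat) (Vs : nat -> seq V)
    (Vn : seq V) : seminorm q -> 0 <= C -> 0 < th -> th < 1 ->
  2^-1 ^+ c <= th ^+ 2 -> (2 ^ J <= n)%N ->
  (forall x, enorm b x <= 1 -> q x <= C) ->
  (forall j, (j <= J)%N -> (size (Vs j) <= 2 ^ j)%N) ->
  (forall j x, (j <= J)%N -> enorm b x <= 1 -> perp b (Vs j) x -> q x <= C * th ^+ j) ->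
  (size Vn <= n)%N ->
  (forall x, enorm b x <= 1 -> perp b Vn x -> q x <= del) ->
  covered [set x | enorm b x <= 1] (fun x y => q (x - y))
    (del + 2^-1 ^+ a * C * th ^+ J / th * (1 + (1 - th)^-1)) (18 * n * (a + c)).
Proof.
move=> sq C0 th0 th1 cth Jn qC sVs qVs sVn qVn.
have fixed_perp W vs x : (forall v, v \in vs -> oproj b W v = v) ->
    perp b W x -> perp b vs x.
  by move=> fW Wx v /fW fv; rewrite (perp_fixed fv Wx).
(* [l] counts the levels still to be peeled. At [l = J + 1] nothing has been peeled, and the
   truncated [J - l] is 0, so the required bound is just [C]; at [l = 0] only [Vn] remains. *)
have main l U : (l <= J.+1)%N -> orthonormal b U ->
    (forall x, perp_ball U x -> q x <= C * th ^+ (J - l)) ->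
    covered (perp_ball U) (fun x y => q (x - y))
      (del + 2^-1 ^+ a * C * th ^+ J / th * (1 + \sum_(i < l) th ^+ i))
      (6 * n * a + 6 * (\sum_(i < l) 2 ^ (J - i) * (a + c * i)))%N.
  elim: l U => [|l IH] U lJ oU qU.
    have [E [sE oE fE]] := gram_schmidt Vn oU.
    rewrite !big_ord0 muln0 addr0 mulr1.
    apply: covered_le (leqnn _) (covered_peel a (r := del) (L := 0) sq oE
      (leq_trans sE sVn) _ qU _).
    - rewrite addrC lerD2l mulrA subn0 ler_pdivlMr//.
      by rewrite ler_piMr ?(ltW th1)// !mulr_ge0 ?exprn_ge0 ?(ltW th0).
    - by rewrite mulr_ge0 ?exprn_ge0 ?(ltW th0).
    exists [:: 0] => // x [x1 Ex]; exists 0; rewrite ?mem_head// subr0.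
    exact/qVn/(fixed_perp _ _ _ fE).
  have [E [sE oE fE]] := gram_schmidt (Vs (J - l)%N) oU.
  have /IH /(_ oE) : (l <= J.+1)%N by exact: ltnW.
  case=> [x [x1 Ex]|s ss hs].
    by apply: qVs; rewrite ?leq_subr//; exact: (fixed_perp _ _ _ fE).
  apply: covered_le (covered_peel (m := 2 ^ (J - l)) (a + c * l) sq oE
    (leq_trans sE (sVs _ (leq_subr _ _))) _ qU (ex_intro2 _ _ s ss hs)); last first.
  - by rewrite mulr_ge0 ?exprn_ge0 ?(ltW th0).
  - rewrite big_ord_recr/=; apply: eq_leq; ring.
  rewrite big_ord_recr/=; set S := \sum_(i < l) th ^+ i.
  (* This is the purpose of the choice of [c]: one factor [th^l] turns [th^(J - l)] into [th^J], the
     other makes the errors summable in [l]. *)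
  have h1 : 2^-1 ^+ (c * l) <= th ^+ (2 * l).
    by rewrite !exprM lerXn2r// nnegrE exprn_ge0// ltW.
  have h2 : th ^+ (J - l.+1) <= th ^+ (J - l) / th.
    rewrite ler_pdivlMr// -exprSr ler_wiXn2l ?(ltW th0) ?(ltW th1)// subnS.
    by case: (J - l)%N.
  have key : 2^-1 ^+ (a + c * l) * (C * th ^+ (J - l.+1)) <=
      2^-1 ^+ a * C * th ^+ J / th * th ^+ l.
    have -> : 2^-1 ^+ (a + c * l) * (C * th ^+ (J - l.+1)) =
      2^-1 ^+ a * C * (2^-1 ^+ (c * l) * th ^+ (J - l.+1)) by rewrite exprD; ring.
    have -> : 2^-1 ^+ a * C * th ^+ J / th * th ^+ l =
      2^-1 ^+ a * C * (th ^+ (2 * l) * (th ^+ (J - l) / th)).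
      have -> : th ^+ J = th ^+ (J - l) * th ^+ l.
        by rewrite -exprD subnK// -ltnS.
      by rewrite mul2n -addnn exprD; ring.
    rewrite ler_wpM2l ?mulr_ge0 ?exprn_ge0//.
    by apply: ler_pM; rewrite ?exprn_ge0// ltW.
  by move: key; lra.
rewrite (_ : [set x | enorm b x <= 1] = perp_ball [::]); last first.
  by apply/seteqP; split => [x x1|x [x1 _]//]; split.
apply: covered_le (main J.+1 [::] (leqnn _) _ _) => //.
- rewrite lerD2l ler_wpM2l ?lerD2l ?sum_geometric_le ?(ltW th0)//.
  by rewrite !mulr_ge0 ?invr_ge0 ?exprn_ge0 ?(ltW th0).
- have := sum_level_sizes a c (leqnn J.+1); rewrite subnn expn0 expnS; nia.
- by move=> x [x1 _]; rewrite subnS subnn mulr1; exact: qC.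
Qed.

End Carl.

(** * Functions of a reproducing kernel Hilbert space *)

Section Hilbert.
Context {R : realType} {H : completeNormedModType R} (ip : {dot H for idfun}).
Hypothesis ip_norm : forall f : H, ip f f = `|f| ^+ 2.

Lemma enorm_normr f : enorm ip f = `|f|.
Proof. by rewrite /enorm ip_norm sqrtr_sqr normr_id. Qed.

(** The projection theorem: a minimizing sequence for the distance from [f] to [P] is Cauchy by the
    parallelogram identity, and the residual at its limit is orthogonal to [P]. It serves to carry
    measurability over to all of [H]. *)
Lemma closed_subspace_full (P : set H) : P 0 ->
  (forall (a : R) f g, P f -> P g -> P (a *: f + g)) ->
  (forall (u : nat -> H) l, (forall n, P (u n)) -> u @ \oo --> l -> P l) ->
  (forall f, (forall g, P g -> ip f g = 0) -> f = 0) ->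
  forall f, P f.
Proof.
move=> P0 Plin Pcvg Ptriv f.
pose S := [set `|f - g| | g in P]; pose dist := inf S.
have Slb : has_lbound S by exists 0 => _ [g _ <-].
have dist_le g : P g -> dist <= `|f - g|.
  by move=> Pg; apply: ge_inf => //; exists g.
have dist0 : 0 <= dist.
  by apply: lb_le_inf; [exists `|f - 0|; exists 0 | move=> _ [g _ <-]].
pose e n : R := n.+1%:R^-1.
have e0 n : 0 < e n by rewrite invr_gt0.
have /choice[s hs] : forall n, exists g, P g /\ `|f - g| < dist + e n.
  move=> n; have [||_ [g Pg <-] hg] := @inf_lt _ S (dist + e n).
  - by exists `|f - 0|; exists 0.
  - by rewrite -/dist ltrDl e0.
  by exists g.
have parallelogram g g' (dl : R) : 0 < dl -> P g -> P g' ->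
    `|f - g| < dist + dl -> `|f - g'| < dist + dl ->
    `|g - g'| ^+ 2 <= 4 * (2 * dist * dl + dl ^+ 2).
  move=> dl0 Pg Pg' fg fg'.
  have Pm : P (2^-1 *: g + 2^-1 *: g').
    by apply: (Plin) => //; rewrite -[_ *: _]addr0; exact: (Plin).
  have := dist_le _ Pm.
  have em : f - (2^-1 *: g + 2^-1 *: g') = 2^-1 *: ((f - g) + (f - g')).
    have -> : f - g + (f - g') = 2 *: f - (g + g').
      by rewrite scaler_nat mulr2n opprD addrACA.
    by rewrite scalerBr scalerA mulVf// scale1r scalerDr.
  rewrite em normrZ ger0_norm// => hm.
  have eg : g - g' = (f - g') - (f - g).
    by rewrite opprB [RHS]addrC addrA subrK.
  have h1 : dist ^+ 2 <= (2^-1 * `|f - g + (f - g')|) ^+ 2.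
    by rewrite lerXn2r ?nnegrE// mulr_ge0.
  have h2 : `|f - g| ^+ 2 <= (dist + dl) ^+ 2.
    by rewrite lerXn2r ?nnegrE ?addr_ge0// ltW.
  have h3 : `|f - g'| ^+ 2 <= (dist + dl) ^+ 2.
    by rewrite lerXn2r ?nnegrE ?addr_ge0// ltW.
  rewrite eg; move: h1 h2 h3; move: (f - g) (f - g') => x y.
  rewrite exprMn -!ip_norm dotDD dotBl !dotBr (dotC _ y x) !sqrrD; lra.
have e_small (eps : R) : 0 < eps -> exists N, e N < eps.
  move=> eps0; exists (Num.truncn eps^-1).
  by rewrite invf_plt ?posrE// truncnS_gt.
have e_mono m n : (m <= n)%N -> e n <= e m.
  by move=> mn; rewrite lef_pV2 ?posrE// ler_nat.
have e1 n : e n <= 1 by rewrite invf_le1// ler1n.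
have scauchy : cauchy (s @ \oo).
  apply: cauchy_exP => eps eps0.
  have [|N hN] := e_small (eps ^+ 2 / (4 * (2 * dist + 1))).
    by rewrite divr_gt0 ?exprn_gt0//; lra.
  exists (s N); exists N => // n /= Nn; rewrite -ball_normE/=.
  rewrite -(@ltr_pXn2r _ 2) ?nnegrE// ?(ltW eps0)//.
  have := @parallelogram (s N) (s n) (e N) (e0 N) (hs N).1 (hs n).1 (hs N).2 _.
  move=> /(_ (lt_le_trans (hs n).2 _)) /le_lt_trans; apply.
    by rewrite lerD2l e_mono.
  move: hN; rewrite ltr_pdivlMr; last by lra.
  have := e1 N; have := e0 N; nra.
have /cauchy_cvgP/cvg_ex[l sl] := scauchy.
have Pl : P l by apply: Pcvg sl => n; exact: (hs n).1.
have fl : `|f - l| <= dist.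
  apply/ler_addgt0Pr => eps eps0.
  have eps2 : 0 < eps / 2 by lra.
  have [N hN] := e_small _ eps2.
  have /cvgrPdist_lt /(_ _ eps2)[N' _ hN'] := sl.
  have h := hN' (maxn N N') (leq_maxr _ _).
  have := (hs (maxn N N')).2; have := e_mono _ _ (leq_maxl N N').
  have -> : f - l = (f - s (maxn N N')) - (l - s (maxn N N')).
    by rewrite opprB addrA subrK.
  have := ler_normB (f - s (maxn N N')) (l - s (maxn N N')).
  by move: h => /=; lra.
suff -> : f = l by [].
apply/eqP; rewrite -subr_eq0; apply/eqP/Ptriv => g Pg.
set r := f - l; set a := ip r g; set G := ip g g.
have G0 : 0 <= G by exact: dot_ge0.
have key t : 2 * t * a <= t ^+ 2 * G.
  have Pt : P (t *: g + l) by exact: (Plin).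
  have := dist_le _ Pt.
  have -> : f - (t *: g + l) = r - t *: g by rewrite opprD addrCA addrC.
  move=> h; have : `|r| ^+ 2 <= `|r - t *: g| ^+ 2.
    by rewrite lerXn2r ?nnegrE// (le_trans fl).
  have E : ip (r - t *: g) (r - t *: g) = ip r r - 2 * t * a + t ^+ 2 * G.
    by rewrite /a /G; move: (r) => z; rewrite dotBl !dotBr !dotZl !dotZr (dotC _ g z); ring.
  by rewrite -!ip_norm E; lra.
(* The minimizing [t] would be [a / G]; [G + 1] also covers [G = 0]. *)
have := key (a / (G + 1)).
have G1 : 0 < G + 1 by lra.
rewrite expr_div_n (_ : 2 * (a / (G + 1)) * a = 2 * a ^+ 2 * (G + 1) / (G + 1) ^+ 2); last first.
  by field; apply/eqP; lra.
rewrite [leRHS]mulrAC ler_pM2r ?invr_gt0 ?exprn_gt0// => h.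
by apply/eqP; rewrite -sqrf_eq0 eq_le sqr_ge0 andbT; have := sqr_ge0 a; nra.
Qed.

End Hilbert.

Section FunctionSpace.
Context {R : realType} {d : measure_display} {X : measurableType d}
  {mu : {finite_measure set X -> \bar R}}
  {H : completeNormedModType R} {ip : {dot H for idfun}} {ev : H -> X -> R}
  {k : X * X -> R}.
Context (Hfun : is_hilbert_function_space ip ev)
  (Hker : is_reproducing_kernel ip ev k) (kbnd : bounded_kernel k)
  (kmeas : measurable_fun [set: X * X] k).

Lemma ip_normr f : ip f f = `|f| ^+ 2. Proof. by have [] := Hfun. Qed.

Lemma ev_linear (a : R) f g x : ev (a *: f + g) x = a * ev f x + ev g x.
Proof. by have [] := Hfun. Qed.

Lemma evD f g x : ev (f + g) x = ev f x + ev g x.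
Proof. by rewrite -[f in LHS]scale1r ev_linear mul1r. Qed.

Lemma ev0 x : ev 0 x = 0.
Proof. by have := evD 0 0 x; rewrite addr0; lra. Qed.

Lemma evZ (a : R) f x : ev (a *: f) x = a * ev f x.
Proof. by rewrite -[a *: f]addr0 ev_linear ev0 addr0. Qed.

Lemma evB f g x : ev (f - g) x = ev f x - ev g x.
Proof. by rewrite evD -scaleN1r evZ mulN1r. Qed.

Lemma ev_sum n (c : 'I_n -> R) (g : 'I_n -> H) x :
  ev (\sum_i c i *: g i) x = \sum_i c i * ev (g i) x.
Proof.
by elim/big_rec2: _ => [|i y f _ <-]; rewrite ?ev0// evD evZ.
Qed.

Lemma kernel_section : exists kx : X -> H,
  (forall x y, ev (kx x) y = k (x, y)) /\ (forall x f, ip f (kx x) = ev f x).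
Proof.
have /choice[kx h] : forall x, exists kx : H,
    (forall y, ev kx y = k (x, y)) /\ (forall f, ip f kx = ev f x).
  by move=> x; have [kx h1 h2] := Hker x; exists kx.
by exists kx; split => x; have [] := h x.
Qed.

Lemma ev_bounded : exists2 K : R, 0 < K & forall f x, `|ev f x| <= K * `|f|.
Proof.
have [kx [h1 h2]] := kernel_section; have [M hM] := kbnd.
exists (Num.sqrt `|M| + 1) => [|f x]; first by have := sqrtr_ge0 `|M|; lra.
rewrite -h2 (le_trans (cauchy_schwarz_norm _ _ _))// mulrC.
rewrite (enorm_normr ip_normr f) ler_wpM2r//.
rewrite /enorm h2 h1 (le_trans (ler_wsqrtr (_ : _ <= `|M|))) ?lerDl//.
by rewrite (le_trans (ler_norm _))// (le_trans (hM _))// ler_norm.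
Qed.

(** The measurable elements contain all kernel sections, to which only 0 is orthogonal, and they are
    closed because the bounded kernel turns norm convergence into pointwise convergence. *)
Lemma measurable_ev f : measurable_fun [set: X] (ev f).
Proof.
have [kx [h1 h2]] := kernel_section; have [K K0 hK] := ev_bounded.
apply: (closed_subspace_full ip_normr (P := [set f | measurable_fun [set: X] (ev f)])).
- rewrite /= (_ : ev 0 = cst 0); last by apply/funext => x; exact: ev0.
  exact: measurable_cst.
- move=> a g g' mg mg' /=.
  rewrite (_ : ev _ = (fun x => a * ev g x + ev g' x)).
    by apply: measurable_funD => //; exact: measurable_funM.
  by apply/funext => x; exact: ev_linear.
- move=> u l mul ul /=; apply: measurable_fun_cvg mul _ => x _.
  apply/cvgrPdist_lt => e e0.
  have eK : 0 < e / K by rewrite divr_gt0.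
  move/cvgrPdist_lt : ul => /(_ _ eK); apply: filterS => n.
  rewrite -evB => un; rewrite (le_lt_trans (hK _ _))// mulrC.
  by rewrite -ltr_pdivlMr.
move=> g hg; have [_ _ evI] := Hfun; apply: evI; apply/funext => x.
rewrite ev0 -h2; apply: hg => /=.
rewrite (_ : ev (kx x) = k \o pair x); last by apply/funext => y; rewrite h1.
by apply: measurableT_comp => //; exact: measurable_pair1.
Qed.

Lemma ev_Lfun (p : \bar R) (p1 : (1 <= p)%E) f : ev f \in Lfun mu p.
Proof.
have [K K0 hK] := ev_bounded.
apply: (@Lfun_subset _ _ _ mu p +oo%E) => //; [exact: leey|exact: fin_num_measure|exact: leey|].
rewrite inE; apply/andP; split; rewrite inE/=; first exact: measurable_ev.
rewrite /finite_norm unlock; case: ifP => [_|_]; last by rewrite ltry.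
apply: (@le_lt_trans _ _ (K * `|f|)%:E); last by rewrite ltry.
by apply/ess_supP; apply: nearW => x /=; rewrite lee_fin.
Qed.

Section Lp.
Context {p : \bar R} (p1 : (1 <= p)%E).

Definition evL f : LfunType mu p1 := Lfun_Sub p1 (ev_Lfun p1 f).

Lemma evL_linear (a : R) f g : evL (a *: f + g) = a *: evL f + evL g.
Proof. by apply/LfuneqP => x /=; rewrite ev_linear. Qed.

Lemma evL_sum n (c : 'I_n -> R) (g : 'I_n -> H) :
  evL (\sum_i c i *: g i) = \sum_i c i *: evL (g i).
Proof.
elim/big_rec2: _ => [|i y f _ <-]; last by rewrite evL_linear.
by apply/LfuneqP => x /=; rewrite ev0.
Qed.

Definition Lp_seminorm f : R := fine 'N[mu]_p[EFin \o ev f]%E.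

Lemma Lp_seminormE f : (Lp_seminorm f)%:E = 'N[mu]_p[EFin \o ev f]%E.
Proof. exact: (finite_norm_fine (evL f)). Qed.

Lemma seminorm_Lp : seminorm Lp_seminorm.
Proof.
split=> [f g|a f].
  have := ler_LnormD (evL f) (evL g); rewrite /Lp_seminorm.
  by rewrite (_ : _ \o ev (f + g) = EFin \o (ev f \+ ev g))//; apply/funext => x /=; rewrite evD.
apply: EFin_inj; rewrite EFinM !Lp_seminormE.
rewrite -(LnormZ (evL f)); congr (Lnorm _ _ _).
by apply/funext => x /=; rewrite evZ.
Qed.

Lemma Lp_dist_evL f g : Lp_dist ev f (evL g) = (Lp_seminorm (f - g))%:E.
Proof.
rewrite Lp_seminormE /Lp_dist; congr (Lnorm _ _ _).
by apply/funext => x /=; rewrite evB.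
Qed.

Lemma Lp_dist_triangle f g (c : LfunType mu p1) :
  ((Lp_seminorm (f - g))%:E <= Lp_dist ev f c + Lp_dist ev g c)%E.
Proof.
rewrite Lp_seminormE /Lp_dist.
rewrite -(oppe_Lnorm mu (EFin \o (fun x => ev g x - c x))).
have -> : (\- (EFin \o (fun x => ev g x - c x)%R))%E = EFin \o (fun x => c x - ev g x).
  by apply/funext => x /=; rewrite opprB.
have -> : EFin \o ev (f - g) =
    EFin \o ((fun x => ev f x - c x) \+ (fun x => c x - ev g x)).
  by apply/funext => x /=; rewrite evB addrA subrK.
by apply: eminkowski => //; apply: measurable_funB => //; exact: measurable_ev.
Qed.

(** The centres of an entropy cover are arbitrary elements of L_p; replacing each by a point of [A]
    from its ball doubles the radius. [phi] allows nets of row vectors as well as of functions. *)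
Lemma entropy_net (T : choiceType) (A : set T) (phi : T -> H) (n : nat) (r : R) :
  A !=set0 -> (forall x, A x -> `|phi x| <= 1) ->
  (entropy_number mu ev p1 n < r%:E)%E ->
  exists s : seq T, [/\ (size s <= 2 ^ n.-1)%N, forall y, y \in s -> A y &
    forall x, A x -> exists2 y, y \in s & Lp_seminorm (phi x - phi y) <= 2 * r].
Proof.
move=> [x0 Ax0] Aphi /ereal_inf_lt[_ [eps /= [eps0 [c hc]] <-]].
rewrite lte_fin => er.
pose good i x := A x /\ (Lp_dist ev (phi x) (c i) <= eps%:E)%E.
exists [seq xget x0 (good i) | i <- enum 'I_(2 ^ n.-1)]; split.
- by rewrite size_map size_enum_ord.
- move=> _ /mapP[i _ ->]; case: xgetP => [y -> []//|_ //].
move=> x Ax; have [i hi] := hc (phi x) (Aphi x Ax).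
have gx : good i x by split.
exists (xget x0 (good i)); first by apply/mapP; exists i; rewrite ?mem_enum.
have /(_ (ex_intro _ x gx)) [_ gy] := @xgetPex _ x0 (good i).
rewrite -lee_fin (le_trans (Lp_dist_triangle _ _ (c i)))//.
rewrite (le_trans (leeD hi gy))// -EFinD lee_fin; lra.
Qed.

Lemma entropy_le (r : R) L : 0 < r ->
  covered [set f : H | `|f| <= 1] (fun f g => Lp_seminorm (f - g)) r L ->
  (entropy_number mu ev p1 L.+1 <= r%:E)%E.
Proof.
move=> r0 [s ss hs]; apply: ereal_inf_lbound; exists r => //; split => //.
exists (fun i => evL (nth 0 s i)) => f /hs[y ys fy].
have iL : (index y s < 2 ^ L.+1.-1)%N by rewrite (leq_trans _ ss)// index_mem.
by exists (Ordinal iL); rewrite Lp_dist_evL lee_fin/= nth_index.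
Qed.

End Lp.
End FunctionSpace.

(** * The L_2 pairing over a finite measure *)

Section PairingL2.
Context {R : realType} {d : measure_display} {X : measurableType d}
  (mu : {finite_measure set X -> \bar R}).

Definition pairing (f g : X -> R) : R := \int[mu]_x (f x * g x).

Lemma integrable_mul (f g : X -> R) : f \in Lfun mu 2%:E -> g \in Lfun mu 2%:E ->
  mu.-integrable [set: X] (EFin \o (fun x => f x * g x)).
Proof. by move=> f2 g2; apply/Lfun1_integrable; exact: Lfun2_mul_Lfun1. Qed.

Lemma pairing_linearl (a : R) (f g h : X -> R) : f \in Lfun mu 2%:E ->
  g \in Lfun mu 2%:E -> h \in Lfun mu 2%:E ->
  pairing (fun x => a * f x + g x) h = a * pairing f h + pairing g h.
Proof.
move=> f2 g2 h2; have ifh := integrable_mul f2 h2.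
rewrite /pairing -RintegralZl// -RintegralD//; last 2 first.
- have := integrableZl measurableT a ifh; apply: eq_integrable => // x _ /=.
- exact: integrable_mul.
by apply: eq_Rintegral => x _; rewrite mulrDl mulrA.
Qed.

Lemma pairingC f g : pairing f g = pairing g f.
Proof. by apply: eq_Rintegral => x _; rewrite mulrC. Qed.

Lemma pairing_ge0 f : 0 <= pairing f f.
Proof. by apply: Rintegral_ge0 => x _; rewrite -expr2 sqr_ge0. Qed.

Lemma pairing_sum_eq0 n (f : X -> R) (c : 'I_n -> R) (g : 'I_n -> X -> R) :
  f \in Lfun mu 2%:E -> (forall i, g i \in Lfun mu 2%:E) ->
  (forall i, pairing f (g i) = 0) -> pairing f (fun x => \sum_i c i * g i x) = 0.
Proof.
move=> f2 g2 fg0.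
have h i : mu.-integrable [set: X] (EFin \o (fun x => f x * g i x)) by exact: integrable_mul.
have hc i : mu.-integrable [set: X] (EFin \o (fun x => f x * (c i * g i x))).
  have := integrableZl measurableT (c i) (h i); apply: eq_integrable => // x _ /=.
  by rewrite mulrCA.
rewrite /pairing /Rintegral.
under eq_integral do rewrite mulr_sumr -sumEFin.
rewrite (integral_sum measurableT (f := fun i x => (f x * (c i * g i x))%:E))//.
rewrite big1// => i _; rewrite -[LHS]fineK; last exact: integrable_fin_num (hc i).
congr EFin; transitivity (c i * pairing f (g i)); last by rewrite fg0 mulr0.
rewrite /pairing -RintegralZl//; apply: eq_Rintegral => x _.
by rewrite mulrCA.
Qed.

Lemma ae_of_Lnormoo (h : X -> R) (r : R) :
  ('N[mu]_+oo[EFin \o h] <= r%:E)%E -> \forall x \ae mu, `|h x| <= r.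
Proof.
rewrite unlock; case: ifPn => [_ /ess_supP|].
  by apply: filterS => x /=; rewrite lee_fin.
rewrite -leNgt => mu0 _; exists [set: X]; split => //.
by apply/eqP; rewrite eq_le mu0 measure_ge0.
Qed.

Lemma pairing_le (h : X -> R) (r : R) : measurable_fun [set: X] h -> 0 <= r ->
  (\forall x \ae mu, `|h x| <= r) -> h \in Lfun mu 2%:E ->
  pairing h h <= r ^+ 2 * fine (mu [set: X]).
Proof.
move=> mh r0 hr h2.
rewrite -lee_fin /pairing /Rintegral fineK; last first.
  exact: (integrable_fin_num measurableT (integrable_mul h2 h2)).
rewrite EFinM fineK ?fin_num_measure// -integral_cst//.
apply: ae_ge0_le_integral => //=.
- by move=> x _; rewrite lee_fin -expr2 sqr_ge0.
- by apply/measurable_EFinP; exact: measurable_funM.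
- by move=> x _; rewrite lee_fin sqr_ge0.
- apply: filterS hr => x hx _; rewrite lee_fin -expr2 -real_normK ?num_real//.
  by rewrite lerXn2r ?nnegrE.
Qed.

(** Pythagoras: if [f] and [g] are orthogonal, the L_2 norm of [f] is at most that of [f - g], which
    the sup norm controls on a finite measure space. *)
Lemma pairing_le_of_orthogonal (f g : LfunType mu (lee1n 2)) (r : R) : 0 <= r ->
  (\forall x \ae mu, `|f x - g x| <= r) -> pairing f g = 0 ->
  pairing f f <= r ^+ 2 * fine (mu [set: X]).
Proof.
move=> r0 fgr fg0.
have fP := LfunP f; have gP := LfunP g; have fgP := LfunP (f - g).
have -> : pairing f f = pairing (f - g) (f - g) - pairing g g.
  have e1 : pairing (f - g) (f - g) = pairing f (f - g) - pairing g (f - g).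
    transitivity (pairing (fun x => - 1 * g x + f x) (f - g)).
      by congr (pairing _ _); apply/funext => x /=; rewrite mulN1r addrC.
    by rewrite (pairing_linearl (- 1) gP fP fgP); ring.
  have e2 h : (h : X -> R) \in Lfun mu 2%:E ->
      pairing h (f - g) = pairing h f - pairing h g.
    move=> hP; rewrite !(pairingC h).
    transitivity (pairing (fun x => - 1 * g x + f x) h).
      by congr (pairing _ _); apply/funext => x /=; rewrite mulN1r addrC.
    by rewrite (pairing_linearl (- 1) gP fP hP); ring.
  by rewrite e1 !e2// (pairingC g f) fg0; ring.
rewrite lerBlDr (le_trans (pairing_le (r := r) _ r0 _ fgP))//.
by rewrite lerDl pairing_ge0.
Qed.

End PairingL2.

(** * Widths of the embedding *)

Section Widths.
Context {R : realType} {d : measure_display} {X : measurableType d}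
  {mu : {finite_measure set X -> \bar R}}
  {H : completeNormedModType R} {ip : {dot H for idfun}} {ev : H -> X -> R}
  {k : X * X -> R} {alpha c1 c2 : R}.
Context (Hfun : is_hilbert_function_space ip ev)
  (Hker : is_reproducing_kernel ip ev k) (kbnd : bounded_kernel k)
  (kmeas : measurable_fun [set: X * X] k).
Context (alpha_gt0 : 0 < alpha) (alpha_lt2 : alpha < 2) (c1_gt0 : 0 < c1)
  (c2_gt0 : 0 < c2).
Context
  (entropy_oo_le : forall n, (0 < n)%N ->
    (entropy_number mu ev (leey 1) n <= (c1 * n%:R `^ (- alpha^-1))%:E)%E)
  (entropy_2_ge : forall n, (0 < n)%N ->
    ((n%:R `^ (- alpha^-1))%:E <= c2%:E * entropy_number mu ev (lee1n 2) n)%E).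

Local Notation q2 := (@Lp_seminorm R d X mu H ev 2%:E).
Local Notation qoo := (@Lp_seminorm R d X mu H ev +oo%E).
Local Notation rho n := (n%:R `^ (- alpha^-1)).
Local Notation evLoo := (evL (mu := mu) Hfun Hker kbnd kmeas (leey 1)).
Local Notation evL2 := (evL (mu := mu) Hfun Hker kbnd kmeas (lee1n 2)).

(** A bound for the norm of the inclusion of L_oo in L_2. Constants below divide by [sm + 1], which
    is positive without a case distinction. *)
Let sm : R := Num.sqrt (fine (mu [set: X])).

Let Iip := ip_normr Hfun.

Lemma seminorm_oo : seminorm qoo.
Proof. exact: (seminorm_Lp Hfun Hker kbnd kmeas (leey 1)). Qed.

Lemma seminorm_2 : seminorm q2.
Proof. exact: (seminorm_Lp Hfun Hker kbnd kmeas (lee1n 2)). Qed.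

Lemma ev_Lfun2 f : ev f \in Lfun mu 2%:E.
Proof. exact: (ev_Lfun Hfun Hker kbnd kmeas (lee1n 2) f). Qed.

Lemma sqr_seminorm_2 f : q2 f ^+ 2 = pairing mu (ev f) (ev f).
Proof.
apply: EFin_inj; have := poweR_Lnorm mu (EFin \o ev f) (_ : (2%:R : R) != 0).
rewrite -(Lp_seminormE Hfun Hker kbnd kmeas (lee1n 2)) poweR_EFin powR_mulrn; last first.
  exact: (seminorm_ge0 seminorm_2 f).
move=> -> //; rewrite /pairing /Rintegral fineK; last first.
  by apply: (integrable_fin_num measurableT); apply: integrable_mul; exact: ev_Lfun2.
apply: eq_integral => x _; rewrite /= powR_mulrn// real_normK ?num_real//.
Qed.

Lemma le_of_sqr_le_mu (x r : R) : 0 <= x -> 0 <= r ->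
  x ^+ 2 <= r ^+ 2 * fine (mu [set: X]) -> x <= sm * r.
Proof.
move=> x0 r0 h; rewrite -(@ler_pXn2r _ 2) ?nnegrE ?mulr_ge0 ?sqrtr_ge0//.
by rewrite exprMn sqr_sqrtr ?fine_ge0// mulrC.
Qed.

Lemma seminorm_2_le_oo f : q2 f <= sm * qoo f.
Proof.
apply: le_of_sqr_le_mu; first exact: (seminorm_ge0 seminorm_2 f).
  exact: (seminorm_ge0 seminorm_oo f).
rewrite sqr_seminorm_2; apply: pairing_le.
- exact: (measurable_ev Hfun Hker kbnd kmeas f).
- exact: (seminorm_ge0 seminorm_oo f).
- by apply: ae_of_Lnormoo; rewrite -(Lp_seminormE Hfun Hker kbnd kmeas (leey 1)).
- exact: ev_Lfun2.
Qed.

Lemma Lfunoo_Lfun2 (g : LfunType mu (@leey R 1%E)) : (g : X -> R) \in Lfun mu 2%:E.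
Proof.
apply: (@Lfun_subset _ _ _ mu 2%:E +oo%E (lee1n 2) (leey 1)) => //; last exact: LfunP.
- exact: fin_num_measure.
- exact: leey.
Qed.

Lemma seminorm_2_le_of_orthogonal f (g : LfunType mu (@leey R 1%E)) r : 0 <= r ->
  (Lp_dist ev f g <= r%:E)%E -> pairing mu (ev f) g = 0 -> q2 f <= sm * r.
Proof.
move=> r0 /ae_of_Lnormoo fg fg0.
apply: le_of_sqr_le_mu => //; first exact: (seminorm_ge0 seminorm_2 f).
rewrite sqr_seminorm_2.
exact: (pairing_le_of_orthogonal (f := evL2 f)
  (g := Lfun_Sub (lee1n 2) (Lfunoo_Lfun2 g))).
Qed.

Lemma rho_gt0 n : (0 < n)%N -> 0 < rho n :> R.
Proof. by move=> n0; rewrite powR_gt0// ltr0n. Qed.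

Lemma rho_small (eps : R) : 0 < eps -> exists2 n, (0 < n)%N & rho n <= eps :> R.
Proof.
move=> e0; pose N := (Num.truncn (eps `^ (- alpha))).+1.
exists N => //; rewrite powRN invf_ple ?posrE ?powR_gt0 ?ltr0n//.
rewrite -[leLHS](powR_invK (alpha := alpha)) ?invr_ge0 ?(ltW e0) ?gt_eqF//.
rewrite ge0_ler_powR ?nnegrE ?invr_ge0 ?(ltW alpha_gt0) ?powR_ge0//.
by rewrite powRV ?(ltW e0)// -powRN ltW// truncnS_gt.
Qed.

Lemma rho_le m n : (0 < m)%N -> (m <= n)%N -> rho n <= rho m :> R.
Proof.
move=> m0 mn; rewrite !powRN lef_pV2 ?posrE ?powR_gt0 ?ltr0n// ?(leq_trans m0)//.
by rewrite ge0_ler_powR ?nnegrE ?invr_ge0 ?(ltW alpha_gt0)// ler_nat.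
Qed.

Lemma rhoM m n : rho (m * n)%N = rho m * rho n :> R.
Proof. by rewrite natrM powRM. Qed.

Lemma rhoX m j : rho (m ^ j)%N = rho m ^+ j :> R.
Proof.
by elim: j => [|j IH]; rewrite ?expn0 ?expr0 ?powR1// expnS rhoM IH exprS.
Qed.

(** The entropy numbers tend to 0, so the unit ball has a finite net in L_oo, and [E] is an
    orthonormal basis of its span. The net points are taken in the unit ball to keep their
    coordinates in the Euclidean one. *)
Lemma discretization (eps : R) : 0 < eps -> exists2 E : seq H, orthonormal ip E &
  forall f, `|f| <= 1 -> exists2 c : 'rV[R]_(size E),
    enorm (rdot (size E)) c <= 1 & qoo (f - comb c) <= eps.
Proof.
move=> e0; have [|n n0 rn] := @rho_small (eps / (4 * c1)).
  by rewrite divr_gt0// mulr_gt0.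
have en : (entropy_number mu ev (leey 1) n < (eps / 2)%:E)%E.
  apply: le_lt_trans (entropy_oo_le n0) _; rewrite lte_fin.
  by move: rn; rewrite ler_pdivlMr ?mulr_gt0//; lra.
have [||s [_ sA hs]] := entropy_net Hfun Hker kbnd kmeas
  (A := [set f : H | `|f| <= 1]) (phi := id) _ _ en.
- by exists 0; rewrite /= normr0.
- by [].
have [E [_ oE fE]] := gram_schmidt (U := [::]) (b := ip) s erefl.
rewrite cats0 in oE fE; exists E => // f /hs[y ys fy].
exists (\row_(l < size E) ip y E`_l).
  by rewrite -(enorm_comb _ oE) -oproj_comb fE// (enorm_normr Iip); exact: (sA _ ys).
by rewrite -oproj_comb fE// (le_trans fy)//; lra.
Qed.

Lemma comb_seminorm (q : H -> R) (E : seq H) : seminorm q ->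
  seminorm (fun c : 'rV[R]_(size E) => q (comb c)).
Proof.
move=> sq; split=> [x y|a x].
  by rewrite -[x in leLHS]scale1r comb_linear scale1r; exact: seminormD.
rewrite -[a *: x]addr0 comb_linear (_ : comb 0 = 0) ?addr0 ?(seminormZ sq)//.
by rewrite /comb big1// => l _; rewrite mxE scale0r.
Qed.

Lemma comb_sum (E : seq H) n (c : 'I_n -> R) (g : 'I_n -> 'rV[R]_(size E)) :
  comb (\sum_i c i *: g i) = \sum_i c i *: comb (g i).
Proof.
elim/big_rec2: _ => [|i y f _ <-]; last by rewrite comb_linear.
by rewrite /comb big1// => l _; rewrite mxE scale0r.
Qed.

Lemma kolmogorov_approx : exists2 C : R, 0 < C & forall n, (0 < n)%N ->
  exists g : 'I_n -> H, forall f, `|f| <= 1 -> exists c : 'I_n -> R,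
    qoo (f - \sum_i c i *: g i) <= C * rho n.
Proof.
(* One factor 2 makes the entropy bound strict, as choosing a cover below an infimum requires; the
   other comes from [entropy_net]. *)
have c4 : 0 < 4 * c1 by rewrite mulr_gt0.
have [C C0 hC] := kolmogorov_of_entropy alpha_gt0 alpha_lt2 c4.
exists (C + 1); first by rewrite addr_gt0.
move=> n n0; have [E oE hE] := discretization (rho_gt0 n0).
have [|m m0|g hg] := hC (size E) (fun c => qoo (comb c)) _ _ n n0.
- exact: comb_seminorm seminorm_oo.
- have em : (entropy_number mu ev (leey 1) m < (2 * c1 * rho m)%:E)%E.
    apply: le_lt_trans (entropy_oo_le m0) _; rewrite lte_fin.
    by rewrite ltr_pM2r ?rho_gt0//; lra.
  have [||s [ss _ hs]] := entropy_net Hfun Hker kbnd kmeas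
    (A := @unit_row R (size E)) (phi := @comb R H E) _ _ em.
  + by exists 0; rewrite /unit_row/= enorm0.
  + by move=> x x1; rewrite -(enorm_normr Iip) (enorm_comb _ oE).
  exists s => // x /hs[y ys xy]; exists y => //.
  by rewrite combB (le_trans xy)//; lra.
exists (fun i => comb (g i)) => f f1.
have [x x1 fx] := hE f f1; have [c xc] := hg x x1; exists c.
have -> : f - \sum_i c i *: comb (g i) =
    (f - comb x) + comb (x - \sum_i c i *: g i).
  by rewrite combB comb_sum addrA subrK.
by rewrite (le_trans (seminormD seminorm_oo _ _))//; lra.
Qed.

Lemma pow_half_small (x : R) : 0 < x -> exists n : nat, 2^-1 ^+ n <= x.
Proof.
move=> x0; pose n := (Num.truncn x^-1).+1; exists n.
rewrite exprVn invf_ple ?posrE ?exprn_gt0// (le_trans (ltW (truncnS_gt _)))//.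
by rewrite -natrX ler_nat ltnW// ltn_expl.
Qed.

(** An exponential beats a power, checked on integer exponents: [rho 2 >= 2^-b], and for [a = 4^m]
    one has [19 (a + c) <= 2^(e + 2 m)], so it suffices that [e' + b (e + 2 m) <= a], which follows
    from [(m + 1)^2 <= 4^m]. *)
Lemma rho_pow_growth (A : R) (c : nat) :
  exists a : nat, A <= 2 ^+ a * rho (19 * (a + c))%N.
Proof.
have [b hb] := pow_half_small (rho_gt0 (isT : (0 < 2)%N)).
have [e' he'] : exists e', A <= 2 ^+ e'.
  exists (Num.truncn A).+1; rewrite (le_trans (ltW (truncnS_gt _)))//.
  by rewrite -natrX ler_nat ltnW// ltn_expl.
pose e := (19 * (1 + c))%N; have he : (19 * (1 + c) <= 2 ^ e)%N by rewrite ltnW// ltn_expl.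
pose m := (e' + b * e + 2 * b)%N; pose a := (2 ^ (2 * m))%N.
exists a.
have a1 : (0 < a)%N by rewrite expn_gt0.
have ma : ((m + 1) * (m + 1) <= a)%N.
  by rewrite /a mul2n -addnn expnD leq_mul// addn1 ltn_expl.
have exps : (e' + b * (e + 2 * m) <= a)%N.
  by apply: leq_trans ma; rewrite /m; nia.
have le1 : (19 * (a + c) <= 2 ^ (e + 2 * m))%N.
  by rewrite expnD; apply: leq_trans (leq_mul he (leqnn _)); rewrite -/a; nia.
apply: (@le_trans _ _ (2 ^+ a * rho (2 ^ (e + 2 * m))%N)); last first.
  by rewrite ler_wpM2l ?exprn_ge0// rho_le// muln_gt0 addn_gt0 a1.
rewrite rhoX; apply: (@le_trans _ _ (2 ^+ a * (2^-1 ^+ b) ^+ (e + 2 * m))); last first.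
  by rewrite ler_wpM2l ?exprn_ge0// lerXn2r// nnegrE ?exprn_ge0// ltW// rho_gt0.
rewrite -exprM exprVn ler_pdivlMr ?exprn_gt0//.
apply: (@le_trans _ _ (2 ^+ e' * 2 ^+ (b * (e + 2 * m)))).
  by rewrite ler_wpM2r ?exprn_ge0.
by rewrite -exprD ler_weXn2l// ler1n.
Qed.

Lemma pairing_ev_linear (g : X -> R) (a : R) f h : g \in Lfun mu 2%:E ->
  pairing mu (ev (a *: f + h)) g = a * pairing mu (ev f) g + pairing mu (ev h) g.
Proof.
move=> g2; rewrite -pairing_linearl ?ev_Lfun2//; congr (pairing _ _ _).
by apply/funext => x; rewrite (ev_linear Hfun).
Qed.

Lemma rdot_comb (E : seq H) (phi : H -> R) (x : 'rV[R]_(size E)) :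
  (forall (a : R) f g, phi (a *: f + g) = a * phi f + phi g) ->
  rdot (size E) x (\row_l phi E`_l) = phi (comb x).
Proof.
move=> lphi; have phi0 : phi 0 = 0.
  by have := lphi 1 0 0; rewrite scale1r addr0 mul1r; lra.
rewrite rdotE /comb; elim/big_rec2: _ => [|l y f _ ->]; first by rewrite phi0.
by rewrite lphi mxE.
Qed.

(** If [f] is orthogonal in L_2 to all [g i], it is orthogonal to its own approximant in their span,
    so its L_2 norm is controlled by the approximation error. This supplies the levels of Carl's
    argument. *)
Lemma gelfand_approx : exists2 C : R, 0 < C & forall n, (0 < n)%N ->
  exists g : 'I_n -> H, forall f, `|f| <= 1 ->
    (forall i, pairing mu (ev f) (ev (g i)) = 0) -> q2 f <= C * rho n.
Proof.
have [C C0 hC] := kolmogorov_approx.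
exists (sm * C + 1) => [|n n0].
  by have : 0 <= sm * C by [rewrite mulr_ge0 ?sqrtr_ge0 ?(ltW C0)]; lra.
have [g hg] := hC n n0; exists g => f f1 fg.
have [c fc] := hg f f1.
apply: (@le_trans _ _ (sm * (C * rho n))).
  apply: (seminorm_2_le_of_orthogonal (g := evLoo (\sum_i c i *: g i))).
  - by rewrite mulr_ge0 ?(ltW C0) ?(ltW (rho_gt0 _)).
  - by rewrite Lp_dist_evL lee_fin.
  rewrite (_ : (evLoo _ : X -> R) = (fun x => \sum_i c i * ev (g i) x)); last first.
    by apply/funext => x; rewrite /= (ev_sum Hfun).
  by apply: pairing_sum_eq0 => // *; exact: ev_Lfun2.
by rewrite mulrA ler_wpM2r ?(ltW (rho_gt0 _))//; lra.
Qed.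

Lemma seminorm_2_bounded : exists2 K : R, 0 < K & forall f, q2 f <= K * `|f|.
Proof.
have [K K0 hK] := ev_bounded Hfun Hker kbnd.
have sm0 : 0 <= sm by exact: sqrtr_ge0.
exists (sm * K + 1) => [|f]; first by have : 0 <= sm * K by [rewrite mulr_ge0 ?(ltW K0)]; lra.
apply: (@le_trans _ _ (sm * (K * `|f|))); last first.
  by rewrite mulrA ler_wpM2r//; lra.
apply: le_of_sqr_le_mu; first exact: (seminorm_ge0 seminorm_2 f).
  by rewrite mulr_ge0 ?(ltW K0).
rewrite sqr_seminorm_2; apply: pairing_le.
- exact: (measurable_ev Hfun Hker kbnd kmeas f).
- by rewrite mulr_ge0 ?(ltW K0).
- exact: nearW.
- exact: ev_Lfun2.
Qed.

(** A lower bound for the Gelfand widths of the embedding into L_2. Arbitrary linear functionals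
    admit integrals against functions and inner products with kernel sections alike. *)
Definition gelfand_bound (c : R) : Prop := forall n (phi : 'I_n -> H -> R) del,
  (0 < n)%N ->
  (forall i (a : R) f g, phi i (a *: f + g) = a * phi i f + phi i g) ->
  (forall f, `|f| <= 1 -> (forall i, phi i f = 0) -> q2 f <= del) ->
  c * rho n <= del.

Lemma gelfand_lower : exists2 c : R, 0 < c & gelfand_bound c.
Proof.
have [Cg Cg0 /= hCg] := gelfand_approx.
have [K K0 hK] := seminorm_2_bounded.
pose C := Cg + K; have C0 : 0 < C by rewrite addr_gt0.
pose th : R := rho 2%N.
have th0 : 0 < th by exact: rho_gt0.
have th1 : th < 1.
  rewrite /th powRN invf_lt1 ?powR_gt0// -[ltLHS](powRr0 2) ltr_powR ?ltr1n//.
  by rewrite invr_gt0.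
have [cc hcc] : exists c : nat, 2^-1 ^+ c <= th ^+ 2.
  by apply: pow_half_small; rewrite exprn_gt0.
have sm0 : 0 <= sm by exact: sqrtr_ge0.
(* One [th] comes from [carl_covering], the other from [th ^+ J <= rho n / th], where [J] is the
   integer part of the binary logarithm of [n]; [sm] accounts for the discretization error. *)
pose D := C / th ^+ 2 * (1 + (1 - th)^-1) + sm.
have D0 : 0 < D.
  by rewrite ltr_wpDr// mulr_gt0 ?divr_gt0 ?exprn_gt0// addr_gt0// invr_gt0 subr_gt0.
(* With at most [19 n (a + cc + 1)] as entropy index, [r19 * rho n <= c2 * (del + 2^-a * D * rho
   n)]. This [a] makes the [D] term at most half of the left side, leaving the other half to
   [c2 * del]. *)
have [a ha] := rho_pow_growth (2 * c2 * D) cc.+1.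
set r19 := rho (19 * (a + cc.+1))%N in ha.
have r19_gt0 : 0 < r19 by rewrite rho_gt0// muln_gt0 addn_gt0 orbT.
exists (r19 / (2 * c2)); first by rewrite divr_gt0// mulr_gt0.
move=> n phi del n0 lphi hphi.
have rn0 : 0 < rho n :> R by exact: rho_gt0.
have ia0 : 0 < (2^-1 : R) ^+ a by rewrite exprn_gt0.
have del0 : 0 <= del.
  rewrite -(seminorm0 seminorm_2); apply: hphi => [|i]; first by rewrite normr0.
  by have := lphi i 1 0 0; rewrite scale1r addr0 mul1r; lra.
pose J := trunc_log 2 n.
have /andP[Jn nJ] : (2 ^ J <= n < 2 ^ J.+1)%N by exact: trunc_log_bounds.
have [E oE hE] := discretization (mulr_gt0 ia0 rn0).
have /choice[g hg] : forall j, exists s : seq H, (size s <= 2 ^ j)%N /\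
    forall f, `|f| <= 1 -> (forall h, h \in s -> pairing mu (ev f) (ev h) = 0) ->
    q2 f <= Cg * rho (2 ^ j)%N.
  move=> j; have [|g hg] := hCg (2 ^ j)%N; first by rewrite expn_gt0.
  exists [seq g i | i <- enum 'I_(2 ^ j)]; rewrite size_map size_enum_ord; split => //.
  by move=> f f1 fg; apply: hg => // i; apply/fg/map_f; rewrite mem_enum.
(* In coordinates a linear functional is the dot product with a row, so vanishing under functionals
   becomes the orthogonality that Carl's argument uses. *)
pose row (psi : H -> R) : 'rV[R]_(size E) := \row_l psi E`_l.
pose Vs j := [seq row (fun f => pairing mu (ev f) (ev h)) | h <- g j].
pose Vn := [seq row (phi i) | i <- enum 'I_n].
have ncomb (x : 'rV[R]_(size E)) : enorm (rdot (size E)) x <= 1 -> `|comb x| <= 1.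
  by move=> x1; rewrite -(enorm_normr Iip) (enorm_comb _ oE).
have cov := @carl_covering R _ (rdot (size E)) (fun x => q2 (comb x)) C th del J n a cc Vs Vn
  (comb_seminorm E seminorm_2) (ltW C0) th0 th1 hcc Jn.
have {}cov : covered [set x | enorm (rdot (size E)) x <= 1]
    (fun x y => q2 (comb (x - y)))
    (del + 2^-1 ^+ a * C * th ^+ J / th * (1 + (1 - th)^-1)) (18 * n * (a + cc)).
  apply: cov.
  - move=> x /ncomb x1; rewrite (le_trans (hK _))//.
    by rewrite (le_trans (ler_wpM2l (ltW K0) x1))// mulr1 lerDr ltW.
  - by move=> j _; rewrite size_map; exact: (hg j).1.
  - move=> j x _ /ncomb x1 Vx.
    have : q2 (comb x) <= Cg * rho (2 ^ j)%N.
      apply: (hg j).2 => // h hgj.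
      rewrite -(rdot_comb (phi := fun f => pairing mu (ev f) (ev h))).
        by apply: Vx; apply/mapP; exists h.
      by move=> b f f'; apply: pairing_ev_linear; exact: ev_Lfun2.
    rewrite rhoX -/th => /le_trans; apply.
    by rewrite ler_wpM2r ?exprn_ge0 ?(ltW th0)// lerDl ltW.
  - by rewrite size_map size_enum_ord.
  - move=> x /ncomb x1 Vx; apply: hphi => // i.
    by rewrite -rdot_comb//; apply: Vx; apply/mapP; exists i; rewrite ?mem_enum.
pose r := del + 2^-1 ^+ a * D * rho n.
have r0 : 0 < r by rewrite ltr_wpDl// !mulr_gt0.
have covH : covered [set f : H | `|f| <= 1] (fun f h => q2 (f - h)) r (18 * n * (a + cc)).
  have [s ss hs] := cov; exists [seq comb x | x <- s]; first by rewrite size_map.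
  move=> f f1; have [x x1 fx] := hE f f1; have [y ys xy] := hs x x1.
  exists (comb y); first exact: map_f.
  have h1 : q2 (f - comb x) <= sm * (2^-1 ^+ a * rho n).
    by rewrite (le_trans (seminorm_2_le_oo _))// ler_wpM2l.
  have h2 : th ^+ J <= rho n / th.
    rewrite ler_pdivlMr// -exprSr /th -rhoX rho_le//; exact: ltnW.
  have h3 : 2^-1 ^+ a * C * th ^+ J / th * (1 + (1 - th)^-1) <=
      2^-1 ^+ a * (C / th ^+ 2 * (1 + (1 - th)^-1)) * rho n.
    have -> : 2^-1 ^+ a * C * th ^+ J / th * (1 + (1 - th)^-1) =
      (2^-1 ^+ a * C / th * (1 + (1 - th)^-1)) * th ^+ J by ring.
    have -> : 2^-1 ^+ a * (C / th ^+ 2 * (1 + (1 - th)^-1)) * rho n =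
      (2^-1 ^+ a * C / th * (1 + (1 - th)^-1)) * (rho n / th).
      by rewrite expr2 invfM; ring.
    have t1 : 0 < 1 - th by rewrite subr_gt0.
    rewrite ler_wpM2l// mulr_ge0 ?divr_ge0 ?mulr_ge0 ?(ltW ia0) ?(ltW C0) ?(ltW th0)//.
    by rewrite addr_ge0// invr_ge0 ltW.
  rewrite (le_trans (seminorm_dist seminorm_2 f (comb x) (comb y)))//.
  rewrite -combB (le_trans (lerD h1 xy))// /r /D; lra.
have eL := entropy_le Hfun Hker kbnd kmeas (lee1n 2) r0 covH.
have rL : rho (18 * n * (a + cc)).+1 <= c2 * r.
  rewrite -lee_fin EFinM (le_trans (entropy_2_ge (ltn0Sn _)))//.
  by rewrite lee_pmul2l// ?fin_numE// lte_fin.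
have r19n : r19 * rho n <= rho (18 * n * (a + cc)).+1.
  rewrite -rhoM; apply: rho_le => //; rewrite addnS; move: (a + cc)%N => z.
  have -> : (18 * n * z = 18 * (z * n))%N by ring.
  have -> : (19 * z.+1 * n = 19 * (z * n) + 19 * n)%N by ring.
  by move: (z * n)%N => w; clear -n0; lia.
rewrite mulrAC ler_pdivrMr ?mulr_gt0//.
have h : 2 * c2 * D * 2^-1 ^+ a <= r19.
  by rewrite exprVn ler_pdivrMr ?exprn_gt0// [leRHS]mulrC.
have := ler_wpM2r (ltW rn0) h; have := le_trans r19n rL; rewrite /r; lra.
Qed.
Lemma kolmogorov_width_le : exists2 C : R, 0 < C & forall n, (0 < n)%N ->
  (kolmogorov_width mu ev (leey 1) n <= (C * rho n)%:E)%E.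
Proof.
have [C C0 hC] := kolmogorov_approx; exists C => // n n0.
have [g hg] := hC n n0.
pose F := [set v | exists c : 'I_n -> R, v = \sum_(i < n) c i *: evLoo (g i)].
apply: (@le_trans _ _ (ereal_sup [set ereal_inf [set Lp_dist ev f v | v in F]
                                 | f in unit_ball])).
  by apply: ereal_inf_lbound; exists F => //; exists (fun i => evLoo (g i)).
apply: ge_ereal_sup => _ [f f1 <-]; have [c fc] := hg f f1.
apply: (@le_trans _ _ (Lp_dist ev f (evLoo (\sum_i c i *: g i)))).
  apply: ereal_inf_lbound; exists (evLoo (\sum_i c i *: g i)) => //.
  by exists c; rewrite evL_sum.
by rewrite Lp_dist_evL lee_fin.
Qed.

Lemma LfunType_sumE n (c : 'I_n -> R) (g : 'I_n -> LfunType mu (@leey R 1%E)) :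
  (\sum_i c i *: g i : LfunType mu (leey 1)) = (fun x => \sum_i c i * g i x) :> (X -> R).
Proof.
apply/funext => x.
by elim/big_ind2: _ => // u1 v1 u2 v2 <- <-.
Qed.

Lemma kolmogorov_width_ge : exists2 c : R, 0 < c & forall n, (0 < n)%N ->
  ((c * rho n)%:E <= kolmogorov_width mu ev (leey 1) n)%E.
Proof.
have [c c0 hc] := gelfand_lower.
have sm0 : 0 <= sm by exact: sqrtr_ge0.
exists (c / (2 * (sm + 1))) => [|n n0]; first by rewrite divr_gt0// mulr_gt0//; lra.
have rn0 : 0 < rho n :> R by exact: rho_gt0.
apply/ereal_infP => _ [F [g Fg] <-]; rewrite leNgt; apply/negP => small.
set T := c / (2 * (sm + 1)) * rho n in small.
have T0 : 0 <= T by rewrite mulr_ge0 ?(ltW rn0)// divr_ge0 ?(ltW c0)//; lra.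
have : c * rho n <= sm * T.
  apply: (hc n (fun i f => pairing mu (ev f) (g i))) => // [i a f h|f f1 fg0].
    exact/pairing_ev_linear/Lfunoo_Lfun2.
  have : (ereal_inf [set Lp_dist ev f v | v in F] < T%:E)%E.
    by apply: le_lt_trans small; apply: ereal_sup_ubound; exists f.
  move=> /ereal_inf_lt[_ [v Fv <-] /ltW fv].
  apply: seminorm_2_le_of_orthogonal fv _ => //.
  move: Fv; rewrite Fg => -[a ->]; rewrite LfunType_sumE.
  by apply: pairing_sum_eq0 => // [|i]; [exact: ev_Lfun2|exact: Lfunoo_Lfun2].
have -> : c * rho n = 2 * (sm + 1) * T.
  by rewrite /T mulrA; congr (_ * _); field; apply/eqP; lra.
have Tp : 0 < T by rewrite mulr_gt0// divr_gt0// mulr_gt0//; lra.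
nra.
Qed.

(** The factor 1/2 makes up for a supremum that need not be attained; normalizing an element of the
    unit ball can only increase [q2]. *)
Lemma exists_large_orthogonal (c : R) (n : nat) (ds : seq H) : (0 < n)%N -> 0 < c ->
  gelfand_bound c ->
  (size ds <= n)%N ->
  exists2 f, perp ip ds f & `|f| = 1 /\ c * rho n / 2 <= q2 f.
Proof.
move=> n0 c0 hc sds; apply: contrapT => none.
have rn0 : 0 < rho n :> R by exact: rho_gt0.
have cr0 : 0 < c * rho n by exact: mulr_gt0.
have : c * rho n <= c * rho n / 2.
  (* The default 0 pads [ds] to exactly [n] functionals. *)
  apply: (hc n (fun i f => ip f (nth 0 ds i))) => // [i a f g|f f1 fds].
    by rewrite dotDl dotZl.
  rewrite leNgt; apply/negP => qf; apply: none.
  have f0 : f != 0.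
    by apply: contraTneq qf => ->; rewrite (seminorm0 seminorm_2) -leNgt; lra.
  have nf : 0 < `|f| by rewrite normr_gt0.
  exists (`|f|^-1 *: f).
    move=> u /(nthP 0)[i iu <-]; rewrite dotZl.
    by rewrite (fds (Ordinal (leq_trans iu sds))) mulr0.
  rewrite normrZ gtr0_norm ?invr_gt0// mulVf ?gt_eqF//; split => //.
  rewrite (seminormZ seminorm_2) gtr0_norm ?invr_gt0//.
  by rewrite (le_trans (ltW qf))// ler_peMl ?invf_ge1// (seminorm_ge0 seminorm_2).
by lra.
Qed.

(** Each new function must be orthogonal to those already found and to [ds], together at most [2 n]
    vectors; hence [rho (2 * n)]. *)
Lemma exists_large_orthonormal (c : R) (n : nat) (ds : seq H) : (0 < n)%N -> 0 < c ->
  gelfand_bound c ->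
  (size ds <= n)%N -> forall j, (j <= n)%N ->
  exists U, [/\ orthonormal ip U, size U = j, forall u, u \in U -> perp ip ds u &
    forall u, u \in U -> c * rho (2 * n)%N / 2 <= q2 u].
Proof.
move=> n0 c0 hc sds; elim=> [|j IH] jn; first by exists [::].
have [U [oU sU dU qU]] := IH (ltnW jn).
have [||f fds [f1 qf]] := @exists_large_orthogonal c (2 * n) (U ++ ds) _ c0 hc.
- by rewrite muln_gt0.
- by rewrite size_cat sU mul2n -addnn leq_add// ltnW.
have fU : perp ip U f by move=> u uU; apply: fds; rewrite mem_cat uU.
exists (f :: U); split => /=.
- by apply/orthonormal_cons; split => //; rewrite Iip f1 expr1n.
- by rewrite sU.
- move=> u; rewrite inE => /predU1P[-> v vds|/dU //].
  by apply: fds; rewrite mem_cat vds orbT.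
- by move=> u; rewrite inE => /predU1P[->|/qU].
Qed.

(* The normalized section of the projection onto [U] vanishes on [D], so its
   interpolant is zero. *)
Lemma interpolation_error_ge m (D : 'I_m -> X) (U : seq H) x : orthonormal ip U ->
  (forall u i, u \in U -> ev u (D i) = 0) ->
  ((Num.sqrt (\sum_(u <- U) ev u x ^+ 2))%:E <=
   ereal_sup [set (`|ev f x - interpolant ev D f x|)%:E | f in @unit_ball R H])%E.
Proof.
move=> oU UD; set S := \sum_(u <- U) _.
pose c : 'rV[R]_(size U) := \row_l ev U`_l x.
have S0 : 0 <= S by rewrite sumr_ge0// => u _; rewrite sqr_ge0.
have SE : S = enorm (rdot (size U)) c ^+ 2.
  rewrite sqr_enorm_row /S (big_nth 0) big_mkord.
  by apply: eq_bigr => l _; rewrite mxE.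
have ncS : enorm (rdot (size U)) c = Num.sqrt S.
  by rewrite SE sqrtr_sqr ger0_norm// enorm_ge0.
have ec y : ev (comb c) y = \sum_(l < size U) ev U`_l x * ev U`_l y.
  by rewrite /comb (ev_sum Hfun); apply: eq_bigr => l _; rewrite mxE.
pose f := (Num.sqrt S)^-1 *: comb c.
apply: ereal_sup_ubound; exists f.
  rewrite /unit_ball/= normrZ ger0_norm ?invr_ge0 ?sqrtr_ge0//.
  rewrite -(enorm_normr Iip) (enorm_comb _ oU) ncS.
  (* For [S = 0] the inverse is 0 by convention, so [f = 0] and the claim persists. *)
  by have [->|s0] := eqVneq (Num.sqrt S) 0; rewrite ?mulr0// mulVf.
have fD i : ev f (D i) = 0.
  rewrite (evZ Hfun) ec big1 ?mulr0// => l _.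
  by rewrite UD ?mulr0// mem_nth.
rewrite /interpolant big1 ?subr0; last by move=> i _; rewrite fD mulr0.
rewrite (evZ Hfun) ec.
have -> : \sum_(l < size U) ev U`_l x * ev U`_l x = S.
  by rewrite /S (big_nth 0) big_mkord; apply: eq_bigr => l _; rewrite expr2.
congr EFin; rewrite -{2}(sqr_sqrtr S0) expr2.
have [->|s0] := eqVneq (Num.sqrt S) 0; first by rewrite !mulr0 normr0.
by rewrite mulrA mulVf// mul1r ger0_norm ?sqrtr_ge0.
Qed.

Lemma interpolation_width_ge : exists2 c : R, 0 < c & forall n, (0 < n)%N ->
  ((c * n%:R `^ (- alpha^-1 + 2^-1))%:E <= interpolation_width mu ev n)%E.
Proof.
have [c c0 hc] := gelfand_lower; have [kx [kx1 kx2]] := kernel_section Hker.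
have sm0 : 0 <= sm by exact: sqrtr_ge0.
have r20 : 0 < rho 2%N :> R by exact: rho_gt0.
exists (c * rho 2%N / (4 * (sm + 1))) => [|n n0].
  by rewrite divr_gt0 ?mulr_gt0//; lra.
have rn0 : 0 < rho n :> R by exact: rho_gt0.
apply/ereal_infP => _ [m [D [mn _ ->]]]; rewrite leNgt; apply/negP => small.
have np : 0 < (n%:R : R) by rewrite ltr0n.
have sn0 : 0 < Num.sqrt (n%:R : R) by rewrite sqrtr_gt0.
pose del := c * rho (2 * n)%N / 2.
have del0 : 0 < del by rewrite divr_gt0// mulr_gt0// rho_gt0// muln_gt0.
(* Chosen so that [T^2 * mu X < n * del^2]: an essential error below [T] would contradict the total
   L_2 mass of the [n] functions. *)
pose T := del * Num.sqrt n%:R / (2 * (sm + 1)).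
have TE : c * rho 2%N / (4 * (sm + 1)) * n%:R `^ (- alpha^-1 + 2^-1) = T.
  rewrite powRD; last by apply/implyP => _; rewrite gt_eqF.
  by rewrite powR12_sqrt ?ler0n// /T /del rhoM; field; apply/eqP; lra.
rewrite TE in small.
have sm1 : 0 < sm + 1 by lra.
have T0 : 0 < T by apply: divr_gt0; exact: mulr_gt0.
have sD : (size [seq kx (D i) | i <- enum 'I_m] <= n)%N.
  by rewrite size_map size_enum_ord.
have [U [oU sU dU qU]] := exists_large_orthonormal n0 c0 hc sD (leqnn n).
have UD u i : u \in U -> ev u (D i) = 0.
  move=> uU; rewrite -kx2; apply: dU => //.
  by apply/mapP; exists i; rewrite ?mem_enum.
have ae_le : \forall x \ae mu, \sum_(u <- U) ev u x ^+ 2 <= T ^+ 2.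
  have := ess_sup_ge mu (fun x => ereal_sup
    [set (`|ev f x - interpolant ev D f x|)%:E | f in @unit_ball R H]).
  apply: filterS => x hx.
  have : (Num.sqrt (\sum_(u <- U) ev u x ^+ 2) <= T)%R.
    rewrite -lee_fin (le_trans (interpolation_error_ge x oU UD))//.
    by rewrite (le_trans hx)// ltW.
  have S0 : 0 <= \sum_(u <- U) ev u x ^+ 2 by rewrite sumr_ge0// => u _; rewrite sqr_ge0.
  by rewrite -(@ler_pXn2r _ 2) ?nnegrE ?sqrtr_ge0 ?(ltW T0)// sqr_sqrtr.
have int_sq u : mu.-integrable [set: X] (EFin \o (fun x => ev u x * ev u x)).
  by apply: integrable_mul; exact: ev_Lfun2.
have total : \sum_(u <- U) q2 u ^+ 2 <= T ^+ 2 * fine (mu [set: X]).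
  rewrite -lee_fin EFinM fineK ?fin_num_measure// -integral_cst//.
  rewrite -sumEFin; under eq_bigr => u _.
    rewrite sqr_seminorm_2 /pairing /Rintegral fineK; last first.
      exact: (integrable_fin_num measurableT (int_sq u)).
    over.
  rewrite -(integral_sum measurableT (f := fun u x => (ev u x * ev u x)%:E))//=.
  apply: ae_ge0_le_integral => //=.
  - by move=> x _; rewrite sumEFin lee_fin sumr_ge0// => u _; rewrite -expr2 sqr_ge0.
  - by apply: emeasurable_sum => u; exact: (measurable_int mu (int_sq u)).
  - by move=> x _; rewrite lee_fin sqr_ge0.
  - apply: filterS ae_le => x hx _; rewrite sumEFin lee_fin.
    by under eq_bigr do rewrite -expr2.
have : n%:R * del ^+ 2 <= \sum_(u <- U) q2 u ^+ 2.
  rewrite -sU -[size U](count_predT) -sum1_count natr_sum mulr_suml.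
  rewrite [leLHS]big_seq [leRHS]big_seq; apply: ler_sum => u uU; rewrite mul1r.
  rewrite lerXn2r ?nnegrE ?(ltW del0)//; first exact: (seminorm_ge0 seminorm_2 u).
  exact: qU.
move=> /le_trans/(_ total); apply/negP; rewrite -ltNge.
have sm2 : sm ^+ 2 = fine (mu [set: X]) by rewrite sqr_sqrtr// fine_ge0.
rewrite -sm2 /T expr_div_n exprMn (sqr_sqrtr (ltW np)).
rewrite mulrAC ltr_pdivrMr; last by rewrite exprn_gt0// mulr_gt0//; lra.
have : 0 < del ^+ 2 * n%:R by rewrite mulr_gt0// exprn_gt0.
rewrite [n%:R * _]mulrC => h; rewrite ltr_pM2l//; nra.
Qed.

End Widths.

Theorem corollary4p3 (R : realType) (d : measure_display)
    (X : measurableType d) (mu : {finite_measure set X -> \bar R})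
    (H : completeNormedModType R) (ip : {dot H for idfun}) (ev : H -> X -> R)
    (k : X * X -> R) (alpha : R)
    (H_hilbert : is_hilbert_function_space ip ev)
    (H_kernel : is_reproducing_kernel ip ev k)
    (k_bounded : bounded_kernel k)
    (k_measurable : measurable_fun [set: X * X] k)
    (alpha_gt0 : 0 < alpha) (alpha_lt2 : alpha < 2)
    (entropy_L2_Loo :
      seq_asymp (entropy_number mu ev (p := 2%:E) (lee1n 2))
                (entropy_number mu ev (p := +oo%E) (leey 1)))
    (entropy_Loo :
      seq_asymp (entropy_number mu ev (p := +oo%E) (leey 1))
                (fun n => (n%:R `^ (- alpha^-1))%:E)) :
  seq_asymp (kolmogorov_width mu ev (p := +oo%E) (leey 1))
            (fun n => (n%:R `^ (- alpha^-1))%:E) /\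
  seq_prec (fun n => (n%:R `^ (- alpha^-1 + 2^-1))%:E)
           (interpolation_width mu ev).
Proof.
have [[c0 c0_gt0 e2oo] [c c_gt0 eoo2]] := entropy_L2_Loo.
have [[c1 c1_gt0 eoo_le] [c2 c2_gt0 eoo_ge]] := entropy_Loo.
have oo_le n : (0 < n)%N -> (entropy_number mu ev (leey 1) n <=
    (c1 * n%:R `^ (- alpha^-1))%:E)%E.
  by move=> n0; rewrite EFinM; exact: eoo_le.
have cc_gt0 : 0 < c2 * c by exact: mulr_gt0.
have l2_ge n : (0 < n)%N -> ((n%:R `^ (- alpha^-1))%:E <=
    (c2 * c)%:E * entropy_number mu ev (lee1n 2) n)%E.
  move=> n0; apply: le_trans (eoo_ge n n0) _.
  by rewrite EFinM -muleA lee_pmul2l//; exact: eoo2.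
have of_ge (a b : nat -> \bar R) : (exists2 e : R, 0 < e & forall n, (0 < n)%N ->
    (e%:E * a n <= b n)%E) -> seq_prec a b.
  move=> [e e0 h]; exists e^-1 => [|n n0]; first by rewrite invr_gt0.
  have -> : a n = (e^-1%:E * (e%:E * a n))%E.
    by rewrite muleA -EFinM mulVf ?gt_eqF// mul1e.
  by rewrite lee_pmul2l ?lte_fin ?invr_gt0//; exact: h.
split; first split.
- have [C C0 hC] := kolmogorov_width_le H_hilbert H_kernel k_bounded k_measurable
    alpha_gt0 alpha_lt2 c1_gt0 oo_le.
  by exists C => // n n0; rewrite -EFinM; exact: hC.
- apply: of_ge; have [e e0 he] := kolmogorov_width_ge H_hilbert H_kernel k_bounded
    k_measurable alpha_gt0 alpha_lt2 c1_gt0 cc_gt0 oo_le l2_ge.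
  by exists e => // n n0; rewrite -EFinM; exact: he.
- apply: of_ge; have [e e0 he] := interpolation_width_ge H_hilbert H_kernel k_bounded
    k_measurable alpha_gt0 alpha_lt2 c1_gt0 cc_gt0 oo_le l2_ge.
  by exists e => // n n0; rewrite -EFinM; exact: he.
Qed.
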